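(* For $n>1$ and $k>5$ odd, let $NC(2nk+k,k)$ be the number of non-isomorphic cyclic $(K_{2nk+k},C_k)$-designs. Then there is an integer $N$ such that for all $n\ge N$ and all odd $k>5$: - if $n\equiv 3,5,24,26\pmod{28}$, then $NC(2nk+k,k)\ge \dfrac{(3.35)^n}{k}$; - if $n\not\equiv 3,5,24,26\pmod{28}$, then $NC(2nk+k,k)\ge \dfrac{(2.49)^n}{k}$.
   Context: A $(K_v,C_k)$-design (or $k$-cycle system of the complete graph $K_v$) is a set $\mathcal{B}$ of $k$-cycles of $K_v$ whose edges partition the edge-set of $K_v$. It is cyclic if the vertex-set can be identified with $\mathbb{Z}_v$ in such a way that $B=(b_1,\dots,b_k)\in\mathcal{B}$ implies $B+z=(b_1+z,\dots,b_k+z)\in\mathcal{B}$ for all $z\in\mathbb{Z}_v$. Two $(K_v,C_k)$-designs with cycle sets $\mathcal{B}$ and $\mathcal{B}'$ are isomorphic if there is a permutation of the vertex-set turning $\mathcal{B}$ into $\mathcal{B}'$. $NC(v,k)$ is the number of cyclic $(K_v,C_k)$-designs up to isomorphism. *)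

(* Defs.v *)
From mathcomp Require Import all_boot all_order all_algebra all_fingroup.

Set Implicit Arguments.
Unset Strict Implicit.
Unset Printing Implicit Defensive.

Import GRing.Theory.

Local Open Scope ring_scope.

Section CycleSystems.

Variable V : finType.

Definition complete_edges : {set {set V}} :=
  [set e : {set V} | #|e| == 2].

(* A cycle (b_1, ..., b_k), being a subgraph, is identified with its edge-set
   {{b_1, b_2}, ..., {b_(k-1), b_k}, {b_k, b_1}}; thus rotating or reversing
   the list of vertices gives the same cycle. *)
Definition cycle_edges (b : seq V) : {set {set V}} :=
  [set [set x; next b x] | x in b].

Definition is_kcycle (k : nat) (C : {set {set V}}) : bool :=
  [exists b : k.-tuple V, uniq b && (C == cycle_edges b)].

(* Meant for 3 <= k: for smaller k a list of k vertices is not a cycle. *)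
Definition is_kcycle_system (k : nat) (B : {set {set {set V}}}) : bool :=
  [forall C in B, is_kcycle k C] && partition B complete_edges.

End CycleSystems.

Definition map_cycle (V W : finType) (f : V -> W) (C : {set {set V}}) :
  {set {set W}} := [set f @: e | e : {set V} in C].

Definition map_system (V W : finType) (f : V -> W) (B : {set {set {set V}}}) :
  {set {set {set W}}} := [set map_cycle f C | C : {set {set V}} in B].

(* On cycles given by their vertices, map_cycle is
   (b_1, ..., b_k) |-> (f b_1, ..., f b_k). *)
Lemma map_cycle_edges (V W : finType) (f : V -> W) (b : seq V) :
  injective f -> uniq b ->
  map_cycle f (cycle_edges b) = cycle_edges (map f b).
Proof.
move=> f_inj b_uniq; have f2 x y : f @: [set x; y] = [set f x; f y].
  by rewrite imsetU1 imset_set1.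
apply/setP=> e; apply/imsetP/imsetP.
  case=> e0 /imsetP[x xb ->] ->; exists (f x); first exact: map_f.
  by rewrite f2 (next_map f_inj b_uniq).
case=> y /mapP[x xb ->] ->; exists [set x; next b x].
  by apply/imsetP; exists x.
by rewrite f2 (next_map f_inj b_uniq).
Qed.

Definition isomorphic_systems (V : finType) (B B' : {set {set {set V}}}) :
  bool := [exists s : {perm V}, map_system s B == B'].

Definition translation_invariant (v : nat) (B : {set {set {set 'Z_v}}}) :
  bool :=
  [forall C in B, [forall z : 'Z_v, map_cycle (fun x => x + z) C \in B]].

(* The vertex-set of K_v is the type 'Z_v, which has v elements only when
   1 < v. Its elements are used just as labels: the permutation phi is the
   identification of the vertex-set with the group Z_v. *)
Definition is_cyclic_system (v k : nat) (B : {set {set {set 'Z_v}}}) : bool :=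
  is_kcycle_system k B &&
  [exists phi : {perm 'Z_v}, translation_invariant (map_system phi B)].

Definition NC (v k : nat) : nat :=
  #|equivalence_partition (@isomorphic_systems 'Z_v)
      [set B | is_cyclic_system k B]|.

(* Main.v *)
(** Write k = 2 s + 1, M = 2 n + 1 and v = M k. A translation-invariant system
    is a union of orbits of base cycles, and it is enough that the differences
    of the base cycles, up to sign, are 1, ..., (v - 1) / 2, each once. The
    zigzag that takes its differences in decreasing order has distinct vertices,
    and it closes up under a condition on their alternating sum; in that sum a
    pair x, x + 1 counts 1 or -1 according to the zone in which x lies. One
    difference close to each multiple of M is spent on cycles with short orbits.
    The remaining ones form s runs of n pairs and a half run of n differences,
    and they are shared out among n zigzags, nearly all of which take a pair
    from each of s - 2 runs. Permuting the pairs inside such a run does not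
    affect the closing conditions, so there are at least (n - 2)! ^ (s - 2)
    systems.

    As 1 and 2 are consecutive differences of one of the cycles, an automorphism
    that fixes 0 and 1 is trivial. If s maps the system B to the
    translation-invariant system B', then s^-1 (1 + s x) is an automorphism of
    B, hence determined by two values, and it determines B'. So at most v ^ 2 of
    the systems are isomorphic to a given one, and for large n the quotient
    (n - 2)! ^ (s - 2) / v ^ 2 exceeds 4 ^ n / k for all k >= 7. *)

Require Import Defs.
From mathcomp Require Import all_boot all_order all_algebra all_fingroup zify ring lra.

Set Implicit Arguments.
Unset Strict Implicit.
Unset Printing Implicit Defensive.

Import Order.TTheory GRing.Theory Num.Theory.

Local Open Scope ring_scope.

(** * Isomorphic translation-invariant systems *)

(** The multiples of M cannot simply become cycles of constant step: the walk with step u M closes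
    after k / gcd(u, k) steps, so for composite k it is a k-cycle only when u is prime to k. Moving
    some of them by 2 gives cycles of period m for divisors m of k, and their differences tile the
    indices 1, ..., s when the largest prime of k is split off repeatedly. There remain n k
    differences, exactly enough for n full orbits.

    Closing all these cycles at once is the main obstacle. Nearly all follow one sign pattern, so
    the condition reduces to a constant sum of three positions, solved by i, -2 i and 2 i - i with 2
    i reduced modulo an odd w. This leads to w = 2 floor(n / 2) - 1 and leaves one or two
    exceptional cycles, which absorb the parities of n, s and floor(n / 2).

    To tell the systems apart, the position coming from 2 i - i in the half run is kept fixed: it
    names the cycle i whatever permutations are chosen. The threshold n >= 201 comes from proving 7
    (2 n + 1) ^ 2 4 ^ n <= (n - 2)!. *)

Section MapSystem.

Variable V : finType.
Implicit Types (B : {set {set {set V}}}) (C : {set {set V}}) (s t : {perm V}).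

Lemma map_cycle_comp (f g : V -> V) C :
  map_cycle g (map_cycle f C) = map_cycle (g \o f) C.
Proof.
rewrite /map_cycle -imset_comp; apply: eq_imset => e /=.
by rewrite -imset_comp.
Qed.

Lemma map_system_comp (f g : V -> V) B :
  map_system g (map_system f B) = map_system (g \o f) B.
Proof.
rewrite /map_system -imset_comp; apply: eq_imset => C /=.
exact: map_cycle_comp.
Qed.

Lemma eq_map_cycle (f g : V -> V) C : f =1 g -> map_cycle f C = map_cycle g C.
Proof. by move=> fg; apply: eq_imset => e; apply: eq_imset. Qed.

Lemma eq_map_system (f g : V -> V) B :
  f =1 g -> map_system f B = map_system g B.
Proof. by move=> fg; apply: eq_imset => C; apply: eq_map_cycle. Qed.

Lemma map_cycle_id C : map_cycle id C = C.
Proof.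
rewrite /map_cycle -[RHS]imset_id; apply: eq_imset => e.
exact: imset_id.
Qed.

Lemma map_system_id B : map_system id B = B.
Proof.
rewrite /map_system -[RHS]imset_id; apply: eq_imset => C.
exact: map_cycle_id.
Qed.

Lemma map_systemK s : cancel (map_system s) (map_system (s^-1)%g).
Proof.
move=> B; rewrite map_system_comp -[RHS]map_system_id.
by apply: eq_map_system => x /=; rewrite permK.
Qed.

Lemma isomorphic_systems_equivalence :
  equivalence_rel (@isomorphic_systems V).
Proof.
move=> B B1 B2; split.
  apply/existsP; exists 1%g; apply/eqP; rewrite -[RHS]map_system_id.
  by apply: eq_map_system => x; rewrite perm1.
move=> /existsP[s /eqP sB]; apply/existsP/existsP=> -[t /eqP tB].
  exists (s^-1 * t)%g; apply/eqP; rewrite -tB -sB map_system_comp.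
  by apply: eq_map_system => x /=; rewrite permM permK.
exists (s * t)%g; apply/eqP; rewrite -tB -sB map_system_comp.
by apply: eq_map_system => x /=; rewrite permM.
Qed.

End MapSystem.

(** * Isomorphism classes inside a family of rigid systems *)

Section ClassSize.

Variable v : nat.
Hypothesis v_gt1 : (1 < v)%N.
Implicit Types B : {set {set {set 'Z_v}}}.

Lemma map_system_translation B (z : 'Z_v) :
  translation_invariant B -> map_system (fun x => x + z) B = B.
Proof.
move=> /forall_inP TI; apply/setP=> C; apply/imsetP/idP.
  by case=> C0 /TI/forallP/(_ z) h ->.
move=> CB; exists (map_cycle (fun x => x - z) C).
  exact: (forallP (TI _ CB)).
rewrite map_cycle_comp -[LHS]map_cycle_id.
by apply: eq_map_cycle => x /=; rewrite subrK.
Qed.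

Definition rigid B := forall g : {perm 'Z_v},
  map_system g B = B -> g 0 = 0 -> g 1 = 1 -> g = 1%g.

Let tau : {perm 'Z_v} := perm (@addrI _ (1 : 'Z_v)).

(** Products of permutations act from left to right, so this is x |-> s^-1 (1 + s x), the
    translation by 1 pulled back along [s]. *)
Let pullback (s : {perm 'Z_v}) : {perm 'Z_v} := (s * tau * s^-1)%g.

(** When the pullbacks agree, s^-1 followed by t commutes with the translation by 1. It is therefore
    itself a translation, and a translation preserves [map_system s B]. *)
Lemma pullback_inj B (s t : {perm 'Z_v}) :
  translation_invariant (map_system s B) -> pullback s = pullback t ->
  map_system s B = map_system t B.
Proof.
move=> TI E.
pose u := (s^-1 * t)%g.
have ucomm x : u (1 + x) = 1 + u x.
  have := congr1 (fun p : {perm _} => t (p ((s^-1)%g x))) E.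
  by rewrite /pullback /= !permM !permKV !permE.
have uS n : u n%:R = n%:R + u 0.
  elim: n => [|n IHn]; first by rewrite add0r.
  by rewrite mulrS ucomm IHn addrA.
rewrite -[LHS](map_system_translation (u 0) TI) map_system_comp.
apply: eq_map_system => x /=.
by rewrite -[s x]natr_Zp -uS natr_Zp permM permK.
Qed.

Lemma card_isomorphic_rigid (Fam : {set {set {set {set 'Z_v}}}}) B :
    (forall B', B' \in Fam -> translation_invariant B') ->
    translation_invariant B -> rigid B ->
  (#|[set B' in Fam | isomorphic_systems B B']| <= v ^ 2)%N.
Proof.
move=> FTI TI rB.
pose A := [set B' in Fam | isomorphic_systems B B'].
(* One isomorphism is chosen for each [B']; the default 1 is never reached on [A]. *)
pose sig B' : {perm 'Z_v} :=
  odflt 1%g [pick s : {perm 'Z_v} | map_system s B == B'].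
have sigP B' : B' \in A -> map_system (sig B') B = B'.
  rewrite inE => /andP[_ /existsP[s sB]]; rewrite /sig.
  by case: pickP => [t /eqP //|/(_ s)]; rewrite sB.
pose h B' := (pullback (sig B') 0, pullback (sig B') 1).
have pull_aut B' : B' \in A -> map_system (pullback (sig B')) B = B.
  move=> B'A; have TI' : translation_invariant B'.
    by move: B'A; rewrite inE => /andP[/FTI].
  transitivity (map_system (sig B')^-1%g
    (map_system (fun x => x + 1) (map_system (sig B') B))).
    rewrite !map_system_comp; apply: eq_map_system => x /=.
    by rewrite !permM !permE addrC.
  by rewrite (sigP _ B'A) map_system_translation // -{2}(sigP _ B'A) map_systemK.
have h_inj : {in A &, injective h}.
  move=> B1 B2 B1A B2A [E0 E1].
  rewrite -(sigP _ B1A) -(sigP _ B2A); apply: pullback_inj.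
    by rewrite sigP //; move: B1A; rewrite inE => /andP[/FTI].
  apply/eqP; rewrite eq_mulgV1; apply/eqP; apply: rB.
  - rewrite -[RHS](map_systemK (pullback (sig B2))) (pull_aut _ B2A).
    rewrite -[in RHS](pull_aut _ B1A) map_system_comp.
    by apply: eq_map_system => x /=; rewrite permM.
  - by rewrite permM E0 permK.
  - by rewrite permM E1 permK.
rewrite -(card_in_imset h_inj); apply: leq_trans (max_card _) _.
by rewrite card_prod !card_ord Zp_cast // mulnn.
Qed.

(** The family is cut along the isomorphism classes. A class that meets it contains a rigid member
    of it, and the class bound is applied to that member. *)
Lemma card_family_NC k (Fam : {set {set {set {set 'Z_v}}}}) :
    (forall B, B \in Fam ->
       [/\ is_kcycle_system k B, translation_invariant B & rigid B]) ->
  (#|Fam| <= NC v k * v ^ 2)%N.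
Proof.
move=> FP; pose D := [set B : {set {set {set 'Z_v}}} | is_cyclic_system k B].
pose P := equivalence_partition (@isomorphic_systems 'Z_v) D.
have eqv : {in D & &, equivalence_rel (@isomorphic_systems 'Z_v)}.
  by move=> x y z _ _ _; apply: isomorphic_systems_equivalence.
have partP : partition P D by apply: equivalence_partitionP.
have FD : Fam \subset D.
  apply/subsetP=> B /FP[sys TI _]; rewrite inE /is_cyclic_system sys /=.
  apply/existsP; exists 1%g; congr (is_true (translation_invariant _)): TI.
  rewrite -[LHS]map_system_id; apply: eq_map_system => x.
  by rewrite perm1.
rewrite /NC -/D -/P -sum_nat_const.
have -> : #|Fam| = (\sum_(A in P) #|Fam :&: A|)%N.
  rewrite -sum1_card (eq_bigl (fun B => (B \in D) && (B \in Fam))); last first.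
    by move=> B; rewrite andbC; case: (boolP (B \in Fam)) => // /(subsetP FD).
  rewrite (set_partition_big_cond _ partP) /=.
  apply: eq_bigr => A _; rewrite -sum1_card; apply: eq_bigl => B.
  by rewrite inE andbC.
apply: leq_sum => A AP.
have [->|[B0]] := set_0Vmem (Fam :&: A); first by rewrite cards0.
rewrite inE => /andP[B0F B0A]; have [_ TI0 r0] := FP _ B0F.
apply: leq_trans (card_isomorphic_rigid _ TI0 r0 (Fam := Fam)); last first.
  by move=> B /FP[].
apply/subset_leq_card/subsetP=> B; rewrite !inE => /andP[BF BA].
rewrite BF /= -(pblock_equivalence_partition eqv) ?(subsetP FD) //.
by rewrite -/P (def_pblock _ AP B0A) //; case/and3P: partP.
Qed.

End ClassSize.

(** * Cyclic systems from base cycles *)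

Section ZpNorm.

Variable v : nat.
Hypotheses (v_gt1 : (1 < v)%N) (v_odd : odd v).
Implicit Types x y : 'Z_v.

Lemma ltn_Zp x : (x < v)%N.
Proof. by case: v v_gt1 x => [|[|p]] // _ x; apply: ltn_ord. Qed.

Lemma val_ZpD x y : val (x + y) = ((x + y) %% v)%N.
Proof. by case: v v_gt1 x y => [|[|p]]. Qed.

Lemma val_ZpN x : val (- x) = ((v - x) %% v)%N.
Proof. by case: v v_gt1 x => [|[|p]]. Qed.

Lemma double_Zp_eq0 x : x + x = 0 -> x = 0.
Proof.
move=> /(congr1 val); rewrite val_ZpD /= => h.
apply/val_inj => /=; have xv := ltn_Zp x.
have /dvdnP[q hq] : (v %| x + x)%N by rewrite /dvdn h.
by case: q hq => [|[|q]] hq; lia.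
Qed.

(** A difference up to sign is represented by its distance to 0 around the circle. *)
Definition Zp_norm x : nat := minn x (v - x).

Lemma Zp_norm_eq x y : Zp_norm x = Zp_norm y -> x = y \/ x = - y.
Proof.
rewrite /Zp_norm => E; have yv := ltn_Zp y; have xv := ltn_Zp x.
have [xy|xy] : x = y :> nat \/ x = (v - y)%N :> nat by lia.
  by left; apply: val_inj.
by right; apply: val_inj; rewrite val_ZpN -xy modn_small.
Qed.

Lemma Zp_normN x : Zp_norm (- x) = Zp_norm x.
Proof.
rewrite /Zp_norm val_ZpN; have xv := ltn_Zp x.
have [->|x0] := posnP x; first by rewrite subn0 modnn; lia.
by rewrite modn_small //; lia.
Qed.

Lemma Zp_norm_range x : x != 0 -> (0 < Zp_norm x <= v.-1./2)%N.
Proof. by rewrite -val_eqE /= /Zp_norm => x0; have := ltn_Zp x; lia. Qed.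

Lemma Zp_norm_nat d : (d <= v.-1./2)%N -> Zp_norm (d%:R : 'Z_v) = d.
Proof. by move=> dV; rewrite /Zp_norm val_Zp_nat // modn_small; lia. Qed.

End ZpNorm.

Section PeriodicCycles.

Variables (v k : nat).
Hypothesis k_gt2 : (2 < k)%N.
Implicit Types (f : nat -> 'Z_v) (x y z : 'Z_v).

Definition edge_set f : {set {set 'Z_v}} :=
  [set [set f i; f i.+1] | i : 'I_k].

(* The closed walk f 0, f 1, ..., f k = f 0 is a k-cycle whose stabiliser
   contains the translation by z, of order k / m. *)
Definition periodic_cycle (m : nat) z f :=
  [/\ (0 < m)%N, forall i, f (i + m)%N = f i + z, forall i, f (i + k)%N = f i
    & {in gtn k &, injective f}].

Let k_gt0 : (0 < k)%N. Proof. exact: leq_trans k_gt2. Qed.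

Section OneCycle.

Variables (m : nat) (z : 'Z_v) (f : nat -> 'Z_v).
Hypothesis pf : periodic_cycle m z f.

Lemma periodic_modn i : f i = f (i %% k)%N.
Proof.
have [_ _ fk _] := pf; rewrite {1}(divn_eq i k) addnC.
by elim: (i %/ k)%N => [|q IH]; rewrite ?addn0 // mulSnr addnA fk.
Qed.

Lemma periodic_congr i j : i = j %[mod k] -> f i = f j.
Proof. by rewrite periodic_modn [f j]periodic_modn => ->. Qed.

Lemma periodic_divn i : f i = f (i %% m)%N + z *+ (i %/ m)%N.
Proof.
have [m_gt0 fm _ _] := pf; rewrite {1}(divn_eq i m) addnC.
elim: (i %/ m)%N => [|q IH]; first by rewrite addn0 addr0.
by rewrite mulSnr addnA fm IH mulrSr addrA.
Qed.

Lemma mem_edge_set i : [set f i; f i.+1] \in edge_set f.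
Proof.
apply/imsetP; exists (Ordinal (ltn_pmod i k_gt0)) => //=.
rewrite [f i]periodic_modn; congr [set _; _].
by apply: periodic_congr; rewrite -addn1 -[in RHS]addn1 modnDml.
Qed.

Lemma periodic_eq i j : f i = f j -> i = j %[mod k].
Proof.
have [_ _ _ finj] := pf.
rewrite periodic_modn [f j]periodic_modn => /finj; apply; exact: ltn_pmod.
Qed.

Lemma periodic_stepN0 i : f i.+1 != f i.
Proof.
apply/eqP=> /periodic_eq /eqP; rewrite -{2}[i]addn0 -addn1 eqn_modDl.
by rewrite !modn_small //; lia.
Qed.

Lemma is_kcycle_edge_set : is_kcycle k (edge_set f).
Proof.
have [_ _ _ finj] := pf.
have fu : uniq (mkseq f k) by apply/mkseq_uniqP => i j; apply: finj.
have sz : size (mkseq f k) == k by rewrite size_mkseq.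
apply/existsP; exists (Tuple sz); rewrite /= fu /=; apply/eqP/setP=> e.
have nxt i : (i < k)%N -> next (mkseq f k) (f i) = f i.+1.
  move=> ik; have fi : f i \in mkseq f k by apply: map_f; rewrite mem_iota.
  rewrite next_nth fi; case E : (mkseq f k) => [|y p].
    by move: sz; rewrite E /= eq_sym; move: k_gt0; case: (k).
  have -> : index (f i) (y :: p) = i.
    rewrite -E -[X in index X](nth_mkseq (f 0%N) f ik) index_uniq //.
    by rewrite size_mkseq.
  have y0 : y = f 0%N.
    by have := nth_mkseq y f k_gt0; rewrite E.
  have szp : size p = k.-1 by have := congr1 size E; rewrite size_mkseq /=; lia.
  have [ik'|ki] := ltnP i.+1 k.
    have := nth_mkseq y f ik'; rewrite E /= => <- //.
  have ei : i.+1 = k by lia.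
  by rewrite nth_default ?szp ?y0; [rewrite ei [RHS]periodic_modn modnn|lia].
apply/imsetP/imsetP.
  case=> i _ ->; exists (f i); first by apply: map_f; rewrite mem_iota /=.
  by rewrite nxt.
case=> y /mapP[i]; rewrite mem_iota /= => ik -> ->.
by exists (Ordinal ik) => //=; rewrite nxt.
Qed.

(** Needed for rigidity: an automorphism that fixes a block and one of its vertices can only keep or
    exchange the two neighbours of that vertex. *)
Lemma neighbours_edge_set i y :
  [set f i.+1; y] \in edge_set f -> y = f i \/ y = f i.+2.
Proof.
case/imsetP=> j _ /= E.
have : f i.+1 \in [set f j; f j.+1] by rewrite -E set21.
have yj : y \in [set f j; f j.+1] by rewrite -E set22.
have ne : y != f i.+1.
  apply/eqP => yi; have : #|[set f i.+1; y]| = #|[set f j; f j.+1]| by rewrite E.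
  by rewrite !cards2 yi eqxx [f j == _]eq_sym periodic_stepN0.
rewrite !inE => /orP[] /eqP ij; move: yj ne; rewrite !inE ij.
  move=> /orP[/eqP->|/eqP->]; first by rewrite eqxx.
  move=> _; right; move/periodic_eq: ij => ij.
  by apply: periodic_congr; rewrite -addn1 -[i.+2]addn1 -modnDml -ij modnDml.
move=> /orP[/eqP->|/eqP->]; last by rewrite eqxx.
move=> _; left; move/periodic_eq: ij; rewrite -[i.+1]addn1 -[j.+1]addn1 => /eqP.
rewrite eqn_modDr => /eqP ij.
exact: periodic_congr.
Qed.

End OneCycle.

Lemma periodic_translate m z f x :
  periodic_cycle m z f -> periodic_cycle m z (fun i => f i + x).
Proof.
case=> m_gt0 fm fk finj; split=> // [i|i|i j ik jk /addIr]; last exact: finj.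
- by rewrite fm addrAC.
- by rewrite fk.
Qed.

Lemma eq_edge_set f g : f =1 g -> edge_set f = edge_set g.
Proof. by move=> fg; apply: eq_imset => i; rewrite !fg. Qed.

(** Translating by [z] advances the index by [m], which only permutes the edges of the closed
    walk. *)
Lemma edge_set_shift m z f t :
  periodic_cycle m z f -> edge_set (fun i => f i + z *+ t) = edge_set f.
Proof.
move=> pf; have [_ fm _ _] := pf.
have ft g : periodic_cycle m z g -> edge_set (fun i => g i + z) = edge_set g.
  move=> pg; have [_ gm gk _] := pg; apply/setP=> e; apply/imsetP/imsetP.
    case=> i _ -> /=; have := mem_edge_set pg (i + m).
    by case/imsetP=> j _ E; exists j; rewrite // -E -addSn !gm.
  (* The index i + k m - m stands for i - m modulo k, written so that the subtraction is not
     truncated. *)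
  case=> i _ ->; have := mem_edge_set (periodic_translate z pg) (i + k * m - m).
  case/imsetP=> j _ E; exists j => //; rewrite -E.
  have mk : (m <= i + k * m)%N by apply: leq_trans (leq_pmull m k_gt0) (leq_addl _ _).
  rewrite -!gm -subSn // !subnK ?(leq_trans mk) //.
  congr [set _; _]; apply: (periodic_congr pg); last rewrite -addSn.
    by rewrite addnC mulnC modnMDl.
  by rewrite addnC mulnC modnMDl.
elim: t => [|t IH]; first by apply: eq_edge_set => i; rewrite addr0.
rewrite -IH -[RHS](ft (fun i => f i + z *+ t)); last exact: periodic_translate.
by apply: eq_edge_set => i; rewrite mulrSr addrA.
Qed.

Lemma map_cycle_edge_set f z :
  map_cycle (fun x => x + z) (edge_set f) = edge_set (fun i => f i + z).
Proof.
rewrite /map_cycle -imset_comp; apply: eq_imset => i /=.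
by rewrite imsetU1 imset_set1.
Qed.

End PeriodicCycles.

Section BaseSystem.

Variables (v k : nat).
Hypotheses (v_gt1 : (1 < v)%N) (v_odd : odd v) (k_gt2 : (2 < k)%N).
Variables (I : finType) (m : I -> nat) (sh : I -> 'Z_v) (f : I -> nat -> 'Z_v).

(** As this is an image set, the coinciding translates of a cycle with a short orbit are counted
    once. *)
Definition base_system : {set {set {set 'Z_v}}} :=
  [set edge_set k (fun a => f u.1 a + u.2) | u : I * 'Z_v].

Let nrm i a := Zp_norm (f i a.+1 - f i a).

Hypothesis base_periodic : forall i, periodic_cycle k (m i) (sh i) (f i).
Hypothesis norm_inj : forall i j a b, (a < m i)%N -> (b < m j)%N ->
  nrm i a = nrm j b -> i = j /\ a = b.
Hypothesis norm_onto : forall d, (0 < d <= v.-1./2)%N ->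
  exists i a, (a < m i)%N /\ nrm i a = d.

Lemma mem_base_system i z : edge_set k (fun a => f i a + z) \in base_system.
Proof. by apply/imsetP; exists (i, z). Qed.

Lemma base_system_invariant : translation_invariant base_system.
Proof.
apply/forall_inP=> C /imsetP[[i z] _ ->] /=; apply/forallP=> y.
rewrite map_cycle_edge_set; apply/imsetP; exists (i, z + y) => //=.
by apply: eq_edge_set => a; rewrite addrA.
Qed.

Lemma step_modn i a : f i a.+1 - f i a = f i (a %% m i).+1 - f i (a %% m i).
Proof.
have [m_gt0 fm _ _] := base_periodic i; rewrite {1 2}(divn_eq a (m i)).
rewrite addnC; elim: (a %/ m i)%N => [|q IH]; first by rewrite addn0.
by rewrite mulSnr addnA -addSn !fm opprD addrACA subrr addr0 -IH.
Qed.

(** The norm of the common edge determines the base cycle and the index modulo its period. Opposite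
    orientations would give a nonzero difference equal to its own opposite, which is impossible for
    odd [v]. So the two translates differ by multiples of the shift, which preserve the edge set. *)
Lemma common_edge i j a b y z :
    [set f i a + y; f i a.+1 + y] = [set f j b + z; f j b.+1 + z] ->
  edge_set k (fun c => f i c + y) = edge_set k (fun c => f j c + z).
Proof.
move=> E; have [mi fmi _ _] := base_periodic i; have [mj fmj _ _] := base_periodic j.
have ne c : f j c.+1 - f j c != 0.
  by rewrite subr_eq0 (periodic_stepN0 k_gt2 (base_periodic j)).
have cases : (f i a + y = f j b + z /\ f i a.+1 + y = f j b.+1 + z) \/
    (f i a + y = f j b.+1 + z /\ f i a.+1 + y = f j b + z).
  have : f i a + y \in [set f j b + z; f j b.+1 + z] by rewrite -E set21.
  have : f i a.+1 + y \in [set f j b + z; f j b.+1 + z] by rewrite -E set22.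
  have nea : f i a + y != f i a.+1 + y.
    rewrite (inj_eq (addIr y)) eq_sym.
    exact: (periodic_stepN0 k_gt2 (base_periodic i)).
  rewrite !inE => /orP[]/eqP e1 /orP[]/eqP e2; move: nea; rewrite ?e1 ?e2.
  - by rewrite eqxx.
  - by move=> _; right.
  - by move=> _; left.
  - by rewrite eqxx.
have subDr (p q r : 'Z_v) : p - q = (p + r) - (q + r).
  by rewrite opprD addrACA subrr addr0.
have nrmE : nrm i a = nrm j b.
  rewrite /nrm; case: cases => -[e1 e2].
    by rewrite (subDr _ _ y) e1 e2 -subDr.
  have -> : f i a.+1 - f i a = - (f j b.+1 - f j b).
    by rewrite (subDr _ _ y) e1 e2 -subDr opprB.
  exact: Zp_normN.
have [ij ab] : i = j /\ (a %% m i = b %% m j)%N.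
  apply: norm_inj; rewrite ?ltn_pmod //.
  by rewrite /nrm -!step_modn.
subst j.
have {cases} fab : f i a + y = f i b + z.
  case: cases => -[e1 e2] //.
  have d1 : f i a.+1 - f i a = f i b.+1 - f i b.
    by rewrite step_modn ab -step_modn.
  have d2 : f i a.+1 - f i a = - (f i b.+1 - f i b).
    by rewrite (subDr _ _ y) e1 e2 -subDr opprB.
  have /eqP[] := ne b; apply: (double_Zp_eq0 v_gt1 v_odd).
  by rewrite -{1}d1 d2 addNr.
rewrite (periodic_divn (base_periodic i) a) in fab.
rewrite (periodic_divn (base_periodic i) b) ab -!addrA in fab.
move/addrI: fab => fab.
have P x := periodic_translate x (base_periodic i).
rewrite -(edge_set_shift k_gt2 (a %/ m i) (P y)).
rewrite -(edge_set_shift k_gt2 (b %/ m i) (P z)).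
by apply: eq_edge_set => c; rewrite -!addrA [y + _]addrC fab [z + _]addrC.
Qed.

(** An edge {x, y} is reached by taking the base edge of the same norm and translating its first end
    to x or to y, according to the sign. Disjointness of the blocks is [common_edge]. *)
Lemma base_system_kcycle_system : is_kcycle_system k base_system.
Proof.
have P i z : periodic_cycle k (m i) (sh i) (fun a => f i a + z).
  exact: periodic_translate.
apply/andP; split.
  apply/forall_inP=> C /imsetP[[i z] _ ->] /=.
  exact: (is_kcycle_edge_set k_gt2 (P i z)).
apply/and3P; split.
- apply/eqP/setP=> e; apply/bigcupP/idP.
    case=> C /imsetP[[i z] _ ->] /imsetP[a _ ->] /=; rewrite inE cards2.
    by have := periodic_stepN0 k_gt2 (P i z) a; rewrite eq_sym => ->.
  rewrite inE => e2; have /cards2P[x [y [xy ->]]] := e2.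
  have [i [a [am na]]] : exists i a, (a < m i)%N /\ nrm i a = Zp_norm (y - x).
    by apply: norm_onto; apply: Zp_norm_range => //; rewrite subr_eq0 eq_sym.
  have [E|E] := Zp_norm_eq v_gt1 v_odd na.
    exists (edge_set k (fun c => f i c + (x - f i a))); first exact: mem_base_system.
    have := mem_edge_set k_gt2 (P i (x - f i a)) a.
    by rewrite addrCA subrr addr0 addrCA addrA [x + _]addrC -addrA E addrC subrK.
  exists (edge_set k (fun c => f i c + (y - f i a))); first exact: mem_base_system.
  have := mem_edge_set k_gt2 (P i (y - f i a)) a.
  rewrite addrCA subrr addr0 addrCA E opprB addrCA subrr addr0.
  by rewrite setUC.
- apply/trivIsetP=> C1 C2 /imsetP[[i y] _ ->] /imsetP[[j z] _ ->] /= ne.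
  apply/pred0P=> e /=; apply/negP=> /andP[/imsetP[a _ ->] /imsetP[b _ E]].
  by move/eqP: ne; apply; apply: common_edge E.
- apply/negP=> /imsetP[[i z] _ E].
  by have := mem_edge_set k_gt2 (P i z) 0; rewrite -E inE.
Qed.

(* An automorphism that fixes both ends of an edge fixes its block. When the
   block contains consecutive vertices y, y + 2 e, y + e, fixing w and w - e
   therefore forces w - 2 e to be fixed. *)
Lemma base_system_rigid i a e : e = 1 \/ e = -1 ->
  f i a.+1 = f i a + e + e -> f i a.+2 = f i a + e -> rigid base_system.
Proof.
move=> e1 fa1 fa2 g gB g0 g1.
have [_ /and3P[_ trivB _]] := andP base_system_kcycle_system.
have e0 : e != 0.
  by case: e1 => ->; rewrite ?oppr_eq0 -val_eqE /=; case: v v_gt1 => [|[|?]].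
have step w : g w = w -> g (w - e) = w - e -> g (w - e - e) = w - e - e.
  move=> gw gwe; pose z := w - f i a.+1.
  have P := periodic_translate z (base_periodic i).
  pose C := edge_set k (fun c => f i c + z).
  have z1 : f i a.+1 + z = w by rewrite /z addrC subrK.
  have z2 : f i a.+2 + z = w - e.
    by rewrite /z fa2 fa1; ring.
  have z0 : f i a + z = w - e - e.
    by rewrite /z fa1; ring.
  have EC : map_cycle g C = C.
    apply/eqP/idPn => ne; have CB := mem_base_system i z.
    have gCB : map_cycle g C \in base_system by rewrite -gB; apply: imset_f.
    have eC : [set w; w - e] \in C.
      by have := mem_edge_set k_gt2 P a.+1; rewrite z1 z2.
    have := trivIsetP trivB _ _ gCB CB ne; rewrite disjoints_subset.
    move/subsetP/(_ [set w; w - e]); rewrite in_setC eC => dis.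
    suff /dis : [set w; w - e] \in map_cycle g C by [].
    apply/imsetP; exists [set w; w - e] => //.
    by rewrite imsetU1 imset_set1 gw gwe.
  have : [set f i a.+1 + z; g (w - e - e)] \in C.
    rewrite -EC; apply/imsetP; exists [set w - e - e; w].
      by have := mem_edge_set k_gt2 P a; rewrite z0 z1.
    by rewrite imsetU1 imset_set1 gw z1 setUC.
  case/(neighbours_edge_set k_gt2 P); rewrite /= ?z0 ?z2 // -{2}gwe => /perm_inj.
  move=> E; case/eqP: e0; rewrite -[LHS](subKr (w - e)) E.
  by rewrite subrr.
(* The two starting points are 1 and 0 when e = 1, and 0 and 1 when e = -1. *)
have [w0 [gw0 gw1]] : exists w, g w = w /\ g (w - e) = w - e.
  by case: e1 => ->; [exists 1; rewrite subrr|exists 0; rewrite opprK add0r].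
have all_fixed t : g (w0 - e *+ t) = w0 - e *+ t /\
    g (w0 - e *+ t - e) = w0 - e *+ t - e.
  elim: t => [|t [IH1 IH2]]; first by rewrite subr0.
  by rewrite mulrSr opprD addrA; split=> //; apply: step.
apply/permP=> x; rewrite perm1.
have [t ->] : exists t, x = w0 - e *+ t.
  case: e1 => ->; [exists (nat_of_ord (w0 - x)%R)|exists (nat_of_ord (x - w0)%R)].
    by rewrite natr_Zp opprB addrC subrK.
  by rewrite mulNrn natr_Zp opprK addrC subrK.
by have [] := all_fixed t.
Qed.

End BaseSystem.

(** * Walks given by natural numbers *)

Section Walks.

Variables (v k : nat).
Hypotheses (v_gt1 : (1 < v)%N) (v_odd : odd v).

Lemma Zp_nat_eq a b : (a%:R = b%:R :> 'Z_v) <-> (a = b %[mod v]).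
Proof.
split=> [/(congr1 (@nat_of_ord _))|E]; first by rewrite !val_Zp_nat.
by apply: val_inj; rewrite /= !val_Zp_nat.
Qed.

(** [W] lists one period and each further period is raised by [z]. Natural numbers are kept as long
    as possible because the zigzag arguments use their order. *)
Definition walk (m z : nat) (W : seq nat) (i : nat) : nat :=
  (nth 0 W (i %% m) + (i %/ m) * z)%N.

Definition walkZ m z W i : 'Z_v := (walk m z W i)%:R.

Variables (m e z : nat) (W ds : seq nat).
Hypotheses (m_gt0 : (0 < m)%N) (e_gt0 : (0 < e)%N) (def_k : k = (m * e)%N).
Hypothesis z_order : (e * z = 0 %[mod v])%N.
Hypothesis walk_inj : forall a b t u, (a < m)%N -> (b < m)%N ->
  (t < e)%N -> (u < e)%N ->
  nth 0%N W a + t * z = nth 0%N W b + u * z %[mod v] -> a = b /\ t = u.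
Hypothesis ds_range : forall a, (a < m)%N -> (0 < nth 0 ds a <= v.-1./2)%N.
Hypothesis walk_step : forall a, (a < m)%N ->
  walk m z W a.+1 = (walk m z W a + nth 0 ds a)%N %[mod v] \/
  walk m z W a.+1 + nth 0%N ds a = walk m z W a %[mod v].

Lemma walk_periodic : periodic_cycle k m (z%:R : 'Z_v) (walkZ m z W).
Proof.
have stepm i : walk m z W (i + m) = (walk m z W i + z)%N.
  by rewrite /walk modnDr divnDr // divnn m_gt0 mulnDl mul1n addnA.
split=> //.
- by move=> i; rewrite /walkZ stepm natrD.
- have stepk t i : walk m z W (i + t * m) = (walk m z W i + t * z)%N.
    elim: t => [|t IH]; first by rewrite !addn0.
    by rewrite mulSn [(m + _)%N]addnC addnA stepm IH -addnA mulSn [(z + _)%N]addnC.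
  move=> i; apply/Zp_nat_eq; rewrite def_k mulnC stepk.
  by rewrite -modnDmr z_order mod0n addn0.
move=> i j; rewrite !inE => ik jk /Zp_nat_eq; rewrite /walk => E.
have [ij1 ij2] : (i %% m = j %% m)%N /\ (i %/ m = j %/ m)%N.
  apply: walk_inj E; rewrite ?ltn_pmod // ltn_divLR //; by rewrite mulnC -def_k.
by rewrite (divn_eq i m) (divn_eq j m) ij1 ij2.
Qed.

Lemma walk_norm a : (a < m)%N ->
  Zp_norm (walkZ m z W a.+1 - walkZ m z W a) = nth 0%N ds a.
Proof.
move=> am; have /andP[_ dV] := ds_range am.
case: (walk_step am) => /Zp_nat_eq; rewrite natrD -!/(walkZ _ _ _ _) => E.
  by rewrite E addrC addKr (Zp_norm_nat v_gt1).
by rewrite -E opprD addrA subrr add0r Zp_normN // (Zp_norm_nat v_gt1).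
Qed.

End Walks.

(** * Zigzags *)

(** The starting point [x] is left out of the list. The truncated subtraction is exact when [D]
    decreases and a first step down is at most [x]. *)
Fixpoint zigzag (up : bool) (x : nat) (D : seq nat) : seq nat :=
  if D is d :: D' then
    let y := (if up then x + d else x - d)%N in y :: zigzag (~~ up) y D'
  else [::].

Definition alt (D : seq nat) : int := foldr (fun d a => d%:Z - a) 0 D.

Lemma size_zigzag up x D : size (zigzag up x D) = size D.
Proof. by elim: D up x => //= d D IH up x; rewrite IH. Qed.

(** Each step is shorter than the previous one and goes the other way, so the walk stays inside the
    interval that its first step has crossed and cannot return to its start. *)
Lemma zigzag_bounds up x d D :
    path gtn d D -> 0%N \notin d :: D -> (up || (d <= x)%N) ->
  {in zigzag up x (d :: D), forall y,
     if up then (x < y <= x + d)%N else (x - d <= y < x)%N}.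
Proof.
elim: D d up x => [|d' D IH] d up x /=.
  by move=> _; rewrite inE => d0 h y; rewrite inE => /eqP ->; case: up h => /=; lia.
move=> /andP[d'd pD]; rewrite inE negb_or => /andP[d0 D0] h y.
rewrite inE => /orP[/eqP->|yz]; first by case: up h => /=; lia.
have h' : ~~ up || (d' <= (if up then x + d else x - d))%N.
  by case: up h {yz} => //=; lia.
have /= := IH d' _ _ pD D0 h' y yz.
by case: up h {h' yz} => /=; lia.
Qed.

Lemma zigzag_uniq up x d D :
    path gtn d D -> 0%N \notin d :: D -> (up || (d <= x)%N) ->
  uniq (x :: zigzag up x (d :: D)).
Proof.
elim: D d up x => [|d' D IH] d up x pD D0 h.
  have := zigzag_bounds pD D0 h (mem_head _ _); rewrite /= inE andbT.
  by case: (up); lia.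
have xz : x \notin zigzag up x (d :: d' :: D).
  by apply/negP=> /(zigzag_bounds pD D0 h); case: (up); lia.
rewrite cons_uniq xz; apply: IH; first by case/andP: pD.
  by move: D0; rewrite inE negb_or => /andP[].
by move: pD h => /= /andP[d'd _]; case: (up) => //=; lia.
Qed.

Lemma last_zigzag up x D :
    sorted gtn D -> (up || (head 0 D <= x)%N) ->
  (last x (zigzag up x D))%:Z = if up then x%:Z + alt D else x%:Z - alt D.
Proof.
elim: D up x => [|d D IH] up x; first by case: up; rewrite /= ?addr0 ?subr0.
move=> sD h; rewrite /= IH.
- by case: up h => /= h; lia.
- exact: path_sorted sD.
- by case: up h => //= h; case: D sD {IH} => //= d' D /andP[]; lia.
Qed.

Lemma zigzag_step up x D i :
    sorted gtn D -> (up || (head 0 D <= x)%N) -> (i < size D)%N ->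
  let W := x :: zigzag up x D in
  if up (+) odd i then nth 0%N W i.+1 = (nth 0%N W i + nth 0%N D i)%N
  else (nth 0%N W i.+1 + nth 0%N D i)%N = nth 0%N W i.
Proof.
elim: D up x i => // d D IH up x [|i] sD h.
  by rewrite addbF /=; case: up h => //= h _; lia.
rewrite ltnS => iD; have := IH (~~ up) (if up then x + d else x - d)%N i.
rewrite [odd i.+1]/= addbN -addNb; apply => //; first exact: path_sorted sD.
by case: up h => //= h; case: D sD {IH iD} => //= d' D /andP[]; lia.
Qed.

Lemma alt_cat D E : alt (D ++ E) = alt D + (-1) ^+ size D * alt E.
Proof.
elim: D => [|d D IH] /=; first by rewrite add0r mul1r.
by rewrite IH exprS; ring.
Qed.

(** * Alternating sums of differences in decreasing order *)

Notation desc := (sort geq).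

Lemma geq_trans : transitive geq.
Proof. by move=> y x z /= yx zy; apply: leq_trans zy yx. Qed.

Lemma geq_anti : antisymmetric geq.
Proof. by move=> x y /=; rewrite andbC => /anti_leq. Qed.

Lemma geq_total : total geq.
Proof. by move=> x y /=; apply: leq_total. Qed.

Lemma desc_eq s t : sorted geq t -> perm_eq s t -> desc s = t.
Proof.
move=> st pst; apply: (sorted_eq geq_trans geq_anti _ st).
  exact: sort_sorted geq_total _.
by rewrite perm_sort.
Qed.

Lemma desc_sorted_gtn s : uniq s -> sorted gtn (desc s).
Proof.
move=> us; rewrite gtn_sorted_uniq_geq sort_uniq us.
exact: sort_sorted geq_total _.
Qed.

Lemma desc_split x s : x \notin s ->
  desc s = [seq y <- desc s | (x < y)%N] ++ [seq y <- desc s | (y < x)%N].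
Proof.
move=> xs; have sds := sort_sorted geq_total s.
rewrite [LHS](@desc_eq _ (filter (ltn x) (desc s) ++ filter (gtn x) (desc s))) //.
  rewrite (sorted_pairwise geq_trans) pairwise_cat.
  rewrite -!(sorted_pairwise geq_trans) !(sorted_filter geq_trans) // !andbT.
  apply/allrelP => y z; rewrite !mem_filter /= => /andP[xy _] /andP[zx _].
  exact: ltnW (ltn_trans zx xy).
rewrite perm_sym -(permPr (permEl (perm_filterC (ltn x) s))).
apply: perm_cat; first by rewrite perm_filter // perm_sort.
rewrite (@eq_in_filter _ (gtn x) (predC (ltn x))).
  by rewrite perm_filter // perm_sort.
move=> y; rewrite mem_sort => ys /=; rewrite -leqNgt ltn_neqAle.
by case: eqP => // yx; rewrite -yx ys in xs.
Qed.

Lemma desc_insert x s : x \notin s -> x.+1 \notin s ->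
  desc [:: x, x.+1 & s] =
    [seq y <- desc s | (x < y)%N] ++ [:: x.+1, x & [seq y <- desc s | (y < x)%N]].
Proof.
move=> xs x1s; have sds := sort_sorted geq_total s.
apply: desc_eq; last first.
  rewrite perm_sym; set A := filter _ _; set B := filter _ _.
  apply: perm_trans (permEl (perm_catCA A [:: x.+1; x] B)) _.
  rewrite -desc_split // -[X in perm_eq _ X]/([:: x; x.+1] ++ s).
  apply: perm_cat; last by rewrite perm_sort.
  by rewrite (permEl (perm_catC [:: x.+1] [:: x])).
rewrite (sorted_pairwise geq_trans) pairwise_cat !pairwise_cons.
rewrite -!(sorted_pairwise geq_trans) !(sorted_filter geq_trans) // /= leqnSn /=.
rewrite !andbT; apply/and3P; split.
- apply/allrelP => y z; rewrite !inE !mem_filter /= => /andP[xy ys].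
  case/or3P => [/eqP->|/eqP->|/andP[zx _]]; lia.
- by apply/allP => y; rewrite mem_filter => /andP[/= ? _]; lia.
- by apply/allP => y; rewrite mem_filter => /andP[/= ? _]; lia.
Qed.

(** The new entries are adjacent in decreasing order, so the signs of all the others are kept and
    the pair adds 1 or -1 according to the parity of the number of larger entries. *)
Lemma alt_desc_insert x s : x \notin s -> x.+1 \notin s ->
  alt (desc [:: x, x.+1 & s]) = alt (desc s) + (-1) ^+ count (ltn x) s.
Proof.
move=> xs x1s; rewrite desc_insert // [in RHS](desc_split xs) !alt_cat /=.
rewrite size_filter count_sort -[RHS]/(_ + (-1) ^+ count (fun y => (x < y)%N) s).
have -> : x.+1%:Z = x%:Z + 1 by lia.
by ring.
Qed.

Definition pairs (P : seq nat) : seq nat := flatten [seq [:: x; x.+1] | x <- P].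

Lemma mem_pairs P x : (x \in pairs P) = (x \in P) || ((0 < x)%N && (x.-1 \in P)).
Proof.
elim: P => [|y P IH]; rewrite ?andbF // /pairs /= !inE -/(pairs P) IH.
by case: x {IH} => [|x] //=; rewrite ?orbF ?eqSS //; lia.
Qed.

Lemma size_pairs P : size (pairs P) = (size P).*2.
Proof. by elim: P => // x P /= ->. Qed.

(* The elements of U split the line into zones on which the zigzag crosses
   the consecutive pairs with alternating signs. *)
Lemma alt_desc_pairs U P : uniq (U ++ pairs P) ->
  alt (desc (U ++ pairs P)) =
    alt (desc U) + \sum_(x <- P) (-1) ^+ count (ltn x) U.
Proof.
elim: P => [|x P IH]; first by rewrite big_nil cats0 addr0.
have pE : perm_eq (U ++ pairs (x :: P)) [:: x, x.+1 & U ++ pairs P].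
  by rewrite -[X in perm_eq X _]/(U ++ [:: x; x.+1] ++ pairs P) perm_catCA.
rewrite (perm_uniq pE) (perm_sortP geq_total geq_trans geq_anti _ _ pE) /=.
rewrite inE negb_or => /and3P[/andP[_ xs] x1s uUP].
rewrite alt_desc_insert // IH // big_cons -addrA [X in _ + X]addrC; congr (_ + (_ + _)).
rewrite count_cat exprD -[(-1) ^+ count _ (pairs P)]signr_odd.
suff -> : odd (count (ltn x) (pairs P)) = false by rewrite mulr1.
move: xs x1s; rewrite !mem_cat !negb_or !mem_pairs /= => /andP[_ xP] /andP[_ x1P].
elim: P xP x1P {IH pE uUP} => // y P IH xP x1P; rewrite /= !oddD -/(pairs P) IH.
- by move: xP x1P; rewrite !inE; case: (ltngtP x y); rewrite ?eqxx //; lia.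
- apply: contra xP => h; rewrite !inE.
  by case/orP: h => [->|/andP[-> ->]]; rewrite !orbT.
- by apply: contra x1P => h; rewrite !inE; case/orP: h => ->; rewrite !orbT.
Qed.

(** Here a is the end of the zigzag that starts at 0. With one closing difference the walk steps
    from a = c back to 0; with two it climbs from a by b to v - c and then by c to v, which is 0
    again. *)
Definition closing (v : nat) (U P K : seq nat) : Prop :=
  let a := alt (desc U) + \sum_(x <- P) (-1) ^+ count (ltn x) U in
  match K with
  | [:: c] => ~~ odd (size U) /\ a = c%:Z
  | [:: b; c] => odd (size U) /\ a + b%:Z + c%:Z = v%:Z
  | _ => False
  end.

(** * From a closing zigzag to a base cycle *)

Section ZigzagCycle.

Variables (v k : nat) (U P K : seq nat).
Hypotheses (v_gt1 : (1 < v)%N) (v_odd : odd v) (k_gt2 : (2 < k)%N).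
Hypothesis uniqD : uniq (U ++ pairs P).
Hypothesis range : {in (U ++ pairs P) ++ K, forall x, (0 < x <= v.-1./2)%N}.
Hypothesis sizeE : size ((U ++ pairs P) ++ K) = k.
Hypothesis clos : closing v U P K.

Let D := desc (U ++ pairs P).

(** The one vertex that the walk may have beyond the zigzag. It lies above (v - 1) / 2, while the
    zigzag stays at or below that bound. *)
Let ext : seq nat := if K is [:: _; c] then [:: v - c]%N else [::].

Let walk_list : seq nat := 0%N :: zigzag true 0 D ++ ext.

Let altD : alt D = alt (desc U) + \sum_(x <- P) (-1) ^+ count (ltn x) U.
Proof. exact: alt_desc_pairs. Qed.

Let closP : (exists c, [/\ K = [:: c], ext = [::] & alt D = c%:Z]) \/
  (exists b c, [/\ K = [:: b; c], ext = [:: v - c]%N, (0 < c <= v.-1./2)%N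
     & alt D + b%:Z + c%:Z = v%:Z]).
Proof.
move: clos range; rewrite /closing -altD /ext.
case: K => [|b [|c [|? ?]]] //= [_ E] range'; [left; exists b|right; exists b, c] => //.
by split=> //; apply: range'; rewrite mem_cat !inE eqxx !orbT.
Qed.

Let sortD : sorted gtn D. Proof. exact: desc_sorted_gtn. Qed.

Let sizeD : (size D + size K)%N = k.
Proof. by rewrite -sizeE size_cat size_sort. Qed.

Let rangeD d : d \in D -> (0 < d <= v.-1./2)%N.
Proof. by rewrite mem_sort => dD; apply: range; rewrite mem_cat dD. Qed.

Let D0 : 0%N \notin D.
Proof. by apply/negP => /rangeD. Qed.

Let zig_bound y : y \in zigzag true 0 D -> (0 < y <= v.-1./2)%N.
Proof.
case ED : D => [|d D'] //; have := sortD; rewrite ED /= => pD.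
have D0' := D0; rewrite ED in D0'.
move/(@zigzag_bounds true 0 _ _ pD D0' isT); rewrite add0n => /andP[-> yd] /=.
have /rangeD/andP[_ dV] : d \in D by rewrite ED mem_head.
exact: leq_trans yd dV.
Qed.

Let size_walk_list : size walk_list = k.
Proof.
rewrite /= size_cat size_zigzag -sizeD.
by case: closP => [[c [-> -> _]]|[b [c [-> -> _ _]]]] /=; lia.
Qed.

Let walk_list_lt y : y \in walk_list -> (y < v)%N.
Proof.
rewrite inE mem_cat => /or3P[/eqP->|/zig_bound|]; [lia|lia|].
by case: closP => [[c [_ -> _]]|[b [c [_ -> c0 _]]]] //; rewrite inE => /eqP ->; lia.
Qed.

Let uniq_walk_list : uniq walk_list.
Proof.
have uz : uniq (0%N :: zigzag true 0 D).
  case ED : D => [|d D'] //; have := sortD; rewrite ED /= => pD.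
  by apply: (@zigzag_uniq true 0 d D' pD _ isT); rewrite -ED; apply: D0.
rewrite /walk_list -cat_cons cat_uniq uz /=.
case: closP => [[c [_ -> _]]|[b [c [_ -> c0 _]]]] //=; rewrite orbF andbT inE.
by apply/norP; split; [lia|apply/negP => /zig_bound; lia].
Qed.

Let dsl := D ++ K.

Let walkE a : (a < k)%N -> walk k 0 walk_list a = nth 0%N walk_list a.
Proof. by move=> ak; rewrite /walk muln0 addn0 modn_small. Qed.

Let walkk : walk k 0 walk_list k = 0%N.
Proof. by rewrite /walk muln0 addn0 modnn. Qed.

Let nth_zig a : (a <= size D)%N ->
  nth 0%N walk_list a = nth 0%N (0%N :: zigzag true 0 D) a.
Proof.
by move=> aD; rewrite /walk_list -cat_cons nth_cat /= size_zigzag ltnS aD.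
Qed.

Let zig_step a : (a < size D)%N ->
  if odd a then (nth 0 walk_list a.+1 + nth 0 D a)%N = nth 0%N walk_list a
  else nth 0%N walk_list a.+1 = (nth 0 walk_list a + nth 0 D a)%N.
Proof.
move=> aD; have := @zigzag_step true 0 _ _ sortD isT aD.
by rewrite (nth_zig aD) (nth_zig (ltnW aD)) addTb; case: (odd a).
Qed.

Let nth_last : (nth 0%N walk_list (size D))%:Z = alt D.
Proof.
rewrite nth_zig // -(size_zigzag true 0 D) nth_last /=.
by rewrite (@last_zigzag true) // add0r.
Qed.

Let walk_stepD a : (a < k)%N ->
  walk k 0 walk_list a.+1 = (walk k 0 walk_list a + nth 0 dsl a)%N %[mod v] \/
  (walk k 0 walk_list a.+1 + nth 0 dsl a)%N = walk k 0 walk_list a %[mod v].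
Proof.
move=> ak; rewrite (walkE ak) /dsl nth_cat.
have [aD|Da] := ltnP a (size D).
  have a1k : (a.+1 <= size D)%N by [].
  have K0 : (0 < size K)%N by case: closP => [[c [-> _ _]]|[b [c [-> _ _ _]]]].
  rewrite walkE; last by rewrite -sizeD; lia.
  by have := zig_step aD; case: (odd a) => ->; [right|left].
have kE := sizeD; case: closP => [[c [KE _ E]]|[b [c [KE extE c0 E]]]].
  have aE : a = size D by move: kE; rewrite KE /=; lia.
  have -> : a.+1 = k by move: kE; rewrite KE /=; lia.
  right; rewrite walkk add0n aE subnn KE /=; congr (_ %% _)%N.
  by move: nth_last; rewrite E => -[].
have nthS : nth 0%N walk_list (size D).+1 = (v - c)%N.
  by rewrite /walk_list -cat_cons nth_cat /= size_zigzag ltnn subnn extE.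
have [aE|aE] : a = size D \/ a = (size D).+1 by move: kE; rewrite KE /=; lia.
  left; rewrite aE subnn walkE; last by move: kE; rewrite KE /=; lia.
  by rewrite nthS KE [nth _ [:: b; c] _]/=; congr (_ %% _)%N; have := nth_last; lia.
have -> : a.+1 = k by move: kE; rewrite KE /=; lia.
left; rewrite walkk aE nthS subSnn KE /= subnK; last by lia.
by rewrite modnn mod0n.
Qed.

Let walk_injD a b t u : (a < k)%N -> (b < k)%N -> (t < 1)%N -> (u < 1)%N ->
  nth 0%N walk_list a + t * 0 = nth 0%N walk_list b + u * 0 %[mod v] ->
  a = b /\ t = u.
Proof.
move=> ak bk; rewrite !ltnS !leqn0 => /eqP-> /eqP->; rewrite !addn0 => E; split=> //.
have lt c : (c < k)%N -> (nth 0 walk_list c < v)%N.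
  by move=> ck; apply/walk_list_lt/mem_nth; rewrite size_walk_list.
move: E; rewrite !modn_small ?lt // => /eqP.
by rewrite nth_uniq ?size_walk_list // => /eqP.
Qed.

(** The smallest differences come last, so a zigzag that has the pair 1, 2 ends with the vertices y,
    y + 2 e, y + e, where e is 1 or -1. This is the pattern that rigidity needs. *)
Let desc_tail : 1%N \in P -> exists D1, D = D1 ++ [:: 2; 1]%N.
Proof.
move=> P1; have pE : perm_eq (U ++ pairs P) [:: 1, 2 & U ++ pairs (rem 1%N P)]%N.
  rewrite perm_sym -[X in perm_eq X _]/([:: 1; 2]%N ++ U ++ _).
  rewrite perm_catCA perm_cat2l perm_sym.
  exact: (perm_flatten (perm_map _ (perm_to_rem P1))).
have := uniqD; rewrite (perm_uniq pE) /= inE negb_or => /and3P[/andP[_ s1] s2 _].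
exists [seq y <- desc (U ++ pairs (rem 1%N P)) | (1 < y)%N].
rewrite /D (perm_sortP geq_total geq_trans geq_anti _ _ pE) desc_insert //.
rewrite (@eq_in_filter _ (fun y => y < 1)%N pred0) ?filter_pred0 // => y.
rewrite mem_sort => ys; apply/negbTE; rewrite -leqNgt.
have /rangeD/andP[] // : y \in D.
by rewrite mem_sort (perm_mem pE) !inE ys !orbT.
Qed.

Lemma zigzag_cycle : exists W,
  [/\ periodic_cycle k k (0 : 'Z_v) (walkZ v k 0 W),
     forall a, (a < k)%N -> Zp_norm (walkZ v k 0 W a.+1 - walkZ v k 0 W a) =
       nth 0%N (desc (U ++ pairs P) ++ K) a
   & 1%N \in P -> exists a e, [/\ e = 1 \/ e = -1,
       walkZ v k 0 W a.+1 = walkZ v k 0 W a + e + e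
       & walkZ v k 0 W a.+2 = walkZ v k 0 W a + e]].
Proof.
have ds_range a : (a < k)%N -> (0 < nth 0 dsl a <= v.-1./2)%N.
  move=> ak; apply: range; have : nth 0%N dsl a \in dsl.
    by apply: mem_nth; rewrite /dsl size_cat sizeD.
  by rewrite /dsl !mem_cat mem_sort mem_cat.
exists walk_list; split.
- have k0 : (0 < k)%N by apply: leq_trans k_gt2.
  exact: (walk_periodic v_gt1 k0 (esym (muln1 k)) _ walk_injD).
- by move=> a ak; apply: (walk_norm v_gt1 v_odd (ds := dsl)).
move=> P1; have [D0' ED] := desc_tail P1.
have aD : (size D0' + 2 = size D)%N by rewrite ED size_cat.
have n2 : nth 0%N D (size D0') = 2 by rewrite ED nth_cat ltnn subnn.
have n1 : nth 0%N D (size D0').+1 = 1%N by rewrite ED nth_cat ltnNge leqnSn subSnn.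
have aD1 : ((size D0').+1 < size D)%N by lia.
have Dk : (size D < k)%N.
  by move: sizeD; case: closP => [[c [-> _ _]]|[b [c [-> _ _ _]]]] /=; lia.
have := zig_step aD1; have := zig_step (ltnW aD1).
rewrite n1 n2 [odd _.+1]/=.
(* The parity tells whether the step of length 2 goes down, giving e = -1, or up, giving e = 1. *)
case: (odd (size D0')) => E1 E2; cbn [negb] in E1, E2; exists (size D0').
  exists (-1); split; [by right| |]; rewrite /walkZ !walkE; try lia.
    by rewrite -E1 natrD; ring.
  by rewrite E2 -E1 !natrD; ring.
exists 1; split; [by left| |]; rewrite /walkZ !walkE; try lia.
  by rewrite E1 natrD; ring.
by move: E1; rewrite -E2 addnA => /addIn ->; rewrite natrD.
Qed.

End ZigzagCycle.

(** * Short orbits *)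

Record base_cycle (v : nat) := BaseCycle {
  period : nat; shift : 'Z_v; vertex : nat -> 'Z_v }.

Definition base0 v : base_cycle v := BaseCycle 0 0 (fun=> 0).

Definition step_norms v (b : base_cycle v) : seq nat :=
  [seq Zp_norm (vertex b a.+1 - vertex b a) | a <- iota 0 (period b)].

Definition base_ok v k (L : seq (base_cycle v)) : Prop :=
  forall i, (i < size L)%N -> let b := nth (base0 v) L i in
  periodic_cycle k (period b) (shift b) (vertex b).

Lemma base_ok_cat v k (L1 L2 : seq (base_cycle v)) :
  base_ok k L1 -> base_ok k L2 -> base_ok k (L1 ++ L2).
Proof.
move=> ok1 ok2 i; rewrite size_cat nth_cat => iL.
by case: ltnP => iL1; [apply: ok1|apply: ok2; lia].
Qed.

(** Reduction modulo [m] identifies A with B; what is left is a congruence modulo [e], where [w] is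
    invertible. *)
Lemma coprime_mod_inj m e w A B t u : (A < m)%N -> (B < m)%N ->
    (t < e)%N -> (u < e)%N -> coprime w e ->
    A + t * (w * m) = B + u * (w * m) %[mod m * e] -> A = B /\ t = u.
Proof.
move=> Am Bm te ue cwe E; have m_gt0 : (0 < m)%N by lia.
have AB : A = B.
  move/(congr1 (fun x => x %% m)%N): E; rewrite !modn_dvdm ?dvdn_mulr //.
  by rewrite !mulnA !(addnC _ (_ * m)%N) !modnMDl !modn_small.
split=> //; move/eqP: E; rewrite AB eqn_modDl !mulnA ![(_ * m)%N]mulnC.
rewrite -!muln_modr eqn_pmul2l // ![(_ * w)%N]mulnC.
wlog tu : t u te ue / (u <= t)%N.
  move=> H; case: (leqP u t) => [|/ltnW]; first exact: H.
  by rewrite eq_sym => h1 h2; apply/esym/H.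
rewrite eqn_mod_dvd ?leq_mul2l ?tu ?orbT // -mulnBr Gauss_dvdr 1?coprime_sym //.
move=> /dvdnP[[|q] h]; first by lia.
by move: h; rewrite mulSn; lia.
Qed.

Section ShortCycles.

Variables (n k : nat).
Hypotheses (n_gt0 : (0 < n)%N) (k_gt2 : (2 < k)%N) (k_odd : odd k).

Let M := n.*2.+1.
Let v := (M * k)%N.

Let v_gt1 : (1 < v)%N. Proof. by rewrite /v /M; nia. Qed.
Let v_odd : odd v. Proof. by rewrite /v oddM k_odd /M /= odd_double. Qed.
Let V_eq : v.-1./2 = (k./2 * M + n)%N.
Proof. have := odd_double_half k; rewrite /v /M k_odd; nia. Qed.

Section OneShortCycle.

Variables (m e w : nat).
Hypotheses (m_odd : odd m) (e_gt0 : (0 < e)%N) (def_k : k = (m * e)%N).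
Hypotheses (w_gt0 : (0 < w)%N) (cwe : coprime w e).
Hypothesis top_le : (w * m + m./2 <= k./2)%N.

Let r := m./2.
Let m_eq : m = r.*2.+1.
Proof. by rewrite -[LHS]odd_double_half m_odd. Qed.

Let z := (M * (w * m))%N.

(* The differences u M + 2 for the first m - 1 values of u, followed by
   (w m + r) M: their zigzag runs between the classes of 0 and 2 modulo M and
   advances by z, an element of order e in Z_v. *)
Let ds : seq nat := [seq ((w * m - r + a) * M + 2 * (a < r.*2))%N | a <- iota 0 m].

Let W : seq nat :=
  [seq (if odd a then (w * m + a./2) * M + 2 else (r - a./2) * M)%N | a <- iota 0 m].

Let nthds a : (a < m)%N -> nth 0%N ds a = ((w * m - r + a) * M + 2 * (a < r.*2))%N.
Proof. by move=> am; rewrite (nth_map 0%N) ?size_iota // nth_iota // add0n. Qed.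

Let nthW a : (a < m)%N ->
  nth 0%N W a = (if odd a then (w * m + a./2) * M + 2 else (r - a./2) * M)%N.
Proof. by move=> am; rewrite (nth_map 0%N) ?size_iota // nth_iota // add0n. Qed.

(** Vertices of even and odd index lie in the classes of 0 and 2 modulo [M], which differ since M >=
    3. Within one class the multipliers of [M] are separated by [coprime_mod_inj]. *)
Lemma short_cycle : exists b : base_cycle v,
  periodic_cycle k (period b) (shift b) (vertex b) /\ step_norms b = ds.
Proof.
have m_gt0 : (0 < m)%N by lia.
have rwm : (r < w * m)%N.
  apply: leq_trans (leq_pmull m w_gt0); move: m_eq; clear; lia.
have ez : (e * z = 0 %[mod v])%N.
  by rewrite /z /v def_k mod0n; apply/eqP/dvdnP; exists w; ring.
have inj a b t u : (a < m)%N -> (b < m)%N -> (t < e)%N -> (u < e)%N ->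
    nth 0%N W a + t * z = nth 0%N W b + u * z %[mod v] -> a = b /\ t = u.
  move=> am bm te ue; rewrite !nthW // => E.
  have E2 : odd a = odd b.
    move/(congr1 (fun x => x %% M)%N): E; rewrite !modn_dvdm /v ?dvdn_mulr //.
    have zM x y : ((x + y * z) %% M = x %% M)%N.
      by rewrite /z mulnCA [(M * _)%N]mulnC addnC modnMDl.
    rewrite !zM.
    case: (odd a); case: (odd b) => //; rewrite ?modnMDl modnMl modn_small //.
      by rewrite /M; lia.
    by rewrite /M; lia.
  have ah : (a./2 <= r)%N by move: am m_eq; clear; lia.
  have bh : (b./2 <= r)%N by move: bm m_eq; clear; lia.
  move: E; rewrite -E2; case oa : (odd a).
    have -> x y : ((w * m + x) * M + 2 + y * z)%N =
        (2 + w * m * M + M * (x + y * (w * m)))%N by rewrite /z; ring.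
    have -> x y : ((w * m + x) * M + 2 + y * z)%N =
        (2 + w * m * M + M * (x + y * (w * m)))%N by rewrite /z; ring.
    move/eqP; rewrite eqn_modDl /v -!muln_modr eqn_pmul2l // def_k => /eqP.
    case/(coprime_mod_inj _ _ te ue cwe); move: am bm ah bh m_eq E2 oa; clear; lia.
  have -> x y : (x * M + y * z)%N = (M * (x + y * (w * m)))%N by rewrite /z; ring.
  have -> x y : (x * M + y * z)%N = (M * (x + y * (w * m)))%N by rewrite /z; ring.
  move/eqP; rewrite /v -!muln_modr eqn_pmul2l // def_k => /eqP.
  case/(coprime_mod_inj _ _ te ue cwe); move: am bm ah bh m_eq E2 oa; clear; lia.
have range a : (a < m)%N -> (0 < nth 0 ds a <= v.-1./2)%N.
  move=> am; rewrite nthds // V_eq; set u := (w * m - r + a)%N.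
  have uk : (u + (a < r.*2) <= k./2)%N.
    by rewrite /u; move: rwm top_le; rewrite -/r; set wm := (w * m)%N; lia.
  have := leq_mul uk (leqnn M); have u0 : (0 < u)%N by rewrite /u; lia.
  have := leq_mul u0 (leqnn M); rewrite mul1n mulnDl.
  by case: (a < r.*2)%N => /=; rewrite ?mul1n ?muln1 ?mul0n ?muln0; lia.
have stp a : (a < m)%N ->
    walk m z W a.+1 = (walk m z W a + nth 0 ds a)%N %[mod v] \/
    walk m z W a.+1 + nth 0%N ds a = walk m z W a %[mod v].
  move=> am; rewrite nthds // /walk [(a %% m)%N]modn_small // [(a %/ m)%N]divn_small //.
  rewrite mul0n addn0; have [am1|ma] := ltnP a.+1 m.
    rewrite [(a.+1 %% m)%N]modn_small // [(a.+1 %/ m)%N]divn_small // mul0n addn0 !nthW //=.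
    have ar : (a < r.*2)%N by lia.
    rewrite ar muln1; case oa : (odd a); [right|left]; congr (_ %% _)%N => /=.
      by rewrite addnA -mulnDl; congr (_ * M + 2)%N; lia.
    by rewrite addnA -mulnDl; congr (_ * M + 2)%N; lia.
  have ar : a = r.*2 by lia.
  left; rewrite (_ : a.+1 = m); last by lia.
  rewrite modnn divnn m_gt0 mul1n !nthW // ar odd_double /=.
  rewrite (_ : (m <= r.*2)%N = false); last by lia.
  congr (_ %% _)%N; rewrite doubleK subnn mul0n add0n muln0 addn0 subn0.
  by rewrite /z [(M * _)%N]mulnC -mulnDl; congr (_ * M)%N; lia.
exists (BaseCycle m (z%:R : 'Z_v) (walkZ v m z W)); split.
  by apply: (walk_periodic v_gt1 m_gt0 def_k ez inj).
rewrite /step_norms /=; apply: (@eq_from_nth _ 0%N); rewrite ?size_map //.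
move=> a; rewrite size_iota => am.
rewrite (nth_map 0%N) ?size_iota // nth_iota // add0n.
by apply: (walk_norm v_gt1 v_odd (ds := ds)).
Qed.

End OneShortCycle.

(** The cycle with multiplier w covers the m indices centred at w m. For w = 1, ..., c these blocks
    follow one another without a gap. *)
Lemma short_level m e c (F : nat -> nat) : odd m -> (0 < e)%N -> k = (m * e)%N ->
    (forall w, (0 < w <= c)%N -> coprime w e) -> (c * m + m./2 <= k./2)%N ->
    (forall w a, (w < c)%N -> (a < m)%N ->
       F (m./2.+1 + w * m + a)%N =
         ((m./2.+1 + w * m + a) * M + 2 * (a < m./2.*2))%N) ->
  exists L : seq (base_cycle v), base_ok k L /\
    flatten (map (@step_norms v) L) = map F (iota m./2.+1 (c * m)).
Proof.
move=> m_odd e_gt0 def_k; elim: c => [|c IH] cop top FE.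
  by exists [::]; split=> // i.
case: IH => [w /andP[w0 wc]| |w a wc am|L [okL EL]].
- by apply: cop; lia.
- by apply: leq_trans top; rewrite mulSn; lia.
- by apply: FE => //; lia.
have cop' : coprime c.+1 e by apply: cop; lia.
have [b [pb Eb]] := short_cycle m_odd e_gt0 def_k (ltn0Sn c) cop' top.
exists (rcons L b); split.
  rewrite -cats1; apply: base_ok_cat => // -[|i] //= _.
rewrite -cats1 map_cat flatten_cat EL /= cats0 Eb mulSnr iotaD.
rewrite map_cat; congr (_ ++ _); apply: (@eq_from_nth _ 0%N); rewrite !size_map !size_iota //.
move=> a am; rewrite !(nth_map 0%N) ?size_iota // !nth_iota // add0n FE //.
have h : (c * m + m - m./2 = m./2.+1 + c * m)%N.
  by have := odd_double_half m; rewrite m_odd; lia.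
by rewrite h.
Qed.

(** Induction on [m], splitting off its largest prime q as m = m' q. The indices up to m' / 2 come
    from the induction, and the others form floor(q / 2) blocks of length m'. Their multipliers are
    smaller than q, hence prime to q e, because every prime of [e] is at least q; this is the
    purpose of the condition on primes. *)
Lemma short_cover m e : (0 < e)%N -> k = (m * e)%N ->
    (forall p q, prime p -> prime q -> (p %| m)%N -> (q %| e)%N -> (p <= q)%N) ->
  exists (eps : nat -> bool) (L : seq (base_cycle v)),
    [/\ base_ok k L, eps m./2 = false
      & flatten (map (@step_norms v) L) =
          [seq (u * M + 2 * eps u)%N | u <- iota 1 m./2]].
Proof.
have [N] := ubnP m; elim: N m e => // N IH m e mN e_gt0 def_k pq.
have m_odd : odd m by move: k_odd; rewrite def_k oddM => /andP[].
have [m1|m_gt1] := leqP m 1.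
  exists (fun=> false), [::]; split=> //.
  by rewrite (_ : m./2 = 0%N) //; lia.
pose q := max_pdiv m; have q_pr : prime q := max_pdiv_prime m_gt1.
have /dvdnP[m' def_m] : (q %| m)%N := max_pdiv_dvd m.
have [q_odd m'_odd] : odd q /\ odd m'.
  by move: m_odd; rewrite def_m oddM => /andP[].
have q_gt2 : (2 < q)%N by have := prime_gt1 q_pr; case: (q) q_odd => [|[|[]]].
have m'_lt : (m' < N)%N by rewrite -ltnS; apply: leq_trans mN; rewrite def_m ltnS;
    rewrite ltn_Pmulr ?prime_gt1 // odd_gt0.
have def_k' : k = (m' * (q * e))%N by rewrite def_k def_m mulnA.
have pq' p1 p2 : prime p1 -> prime p2 -> (p1 %| m')%N -> (p2 %| q * e)%N -> (p1 <= p2)%N.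
  move=> pr1 pr2 d1; have d1m : (p1 %| m)%N by rewrite def_m dvdn_mulr.
  rewrite Euclid_dvdM // => /orP[|]; last exact: pq.
  rewrite dvdn_prime2 // => /eqP->; rewrite /q; apply: max_pdiv_max.
  by rewrite mem_primes pr1 d1m (ltnW m_gt1).
have qe_gt0 : (0 < q * e)%N by rewrite muln_gt0 e_gt0; lia.
have [eps [L [okL eps0 EL]]] := IH _ _ m'_lt qe_gt0 def_k' pq'.
(* In each block of m' indices only the last difference is an exact multiple of [M]. The last block
   ends at m / 2, so the value there is false. *)
pose eps' u := if (u <= m'./2)%N then eps u else ~~ (m' %| u - m'./2)%N.
have m'E : m' = m'./2.*2.+1 by rewrite -[LHS]odd_double_half m'_odd.
have qE : q = q./2.*2.+1 by rewrite -[LHS]odd_double_half q_odd.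
have mE : m./2 = (m'./2 + q./2 * m')%N.
  by rewrite def_m; move: m'E qE; clear; nia.
have [|||L' [okL' EL']] := @short_level m' (q * e) q./2
    (fun u => u * M + 2 * eps' u)%N m'_odd qe_gt0 def_k'.
- move=> w /andP[w0 wq]; rewrite coprimeMr; apply/andP; split.
    rewrite coprime_sym prime_coprime //; apply/negP => /(dvdn_leq w0).
    by lia.
  rewrite /coprime; apply/idPn => ne.
  have g1 : (1 < gcdn w e)%N.
    by rewrite ltn_neqAle eq_sym ne gcdn_gt0 w0.
  have pr := pdiv_prime g1; have pd := pdiv_dvd (gcdn w e).
  have pw : (pdiv (gcdn w e) <= w)%N by apply: dvdn_leq (dvdn_trans pd (dvdn_gcdl _ _)).
  have := pq _ _ q_pr pr (max_pdiv_dvd m) (dvdn_trans pd (dvdn_gcdr _ _)).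
  by lia.
- by rewrite def_k [(_ * m' + _)%N]addnC -mE half_leq // leq_pmulr.
- move=> w a wq am; rewrite /eps' ifF; last by lia.
  rewrite (_ : (_ - _)%N = (w * m' + a.+1)%N); last by lia.
  rewrite dvdn_addr ?dvdn_mull //; congr (_ + 2 * _)%N; congr nat_of_bool.
  apply/idP/idP => h.
    by rewrite ltn_neqAle -ltnS -m'E am andbT; apply: contra h => /eqP->; rewrite -m'E.
  by apply/negP => /dvdn_leq; lia.
exists eps', (L ++ L'); split.
- exact: base_ok_cat.
- rewrite /eps' ifF; last by rewrite mE; lia.
  by rewrite mE addKn dvdn_mull.
rewrite map_cat flatten_cat EL EL' mE iotaD map_cat; congr (_ ++ _).
apply/eq_in_map => u; rewrite mem_iota => /andP[_ um].
by rewrite /eps' ifT //; lia.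
Qed.

End ShortCycles.

(** * The system of a list of base cycles *)

Section ListSystem.

Variables (v k : nat).
Hypotheses (v_gt1 : (1 < v)%N) (v_odd : odd v) (k_gt2 : (2 < k)%N).
Implicit Types L : seq (base_cycle v).

Definition list_system L :=
  base_system k (fun i : 'I_(size L) => vertex (nth (base0 v) L i)).

Definition norms L := flatten (map (@step_norms v) L).

Lemma mem_norms L i d : (i < size L)%N ->
  d \in step_norms (nth (base0 v) L i) -> d \in norms L.
Proof.
move=> iL dL; apply/flattenP; exists (step_norms (nth (base0 v) L i)) => //.
apply/(nthP [::]); exists i; first by rewrite size_map.
exact: nth_map.
Qed.

Lemma norms_inj L i j d : uniq (norms L) -> (i < size L)%N -> (j < size L)%N ->
    d \in step_norms (nth (base0 v) L i) -> d \in step_norms (nth (base0 v) L j) ->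
  i = j.
Proof.
rewrite /norms; elim: L i j => // b L IH [|i] [|j] //=; rewrite cat_uniq.
- move=> /and3P[_ /hasPn dis _] _ jL di dj.
  by have := dis _ (mem_norms jL dj); rewrite /= di.
- move=> /and3P[_ /hasPn dis _] iL _ di dj.
  by have := dis _ (mem_norms iL di); rewrite /= dj.
by move=> /and3P[_ _ u] iL jL di dj; congr _.+1; apply: IH.
Qed.

Lemma uniq_step_norms L i : uniq (norms L) -> (i < size L)%N ->
  uniq (step_norms (nth (base0 v) L i)).
Proof.
rewrite /norms; elim: L i => // b L IH [|i] //=; rewrite cat_uniq.
  by case/and3P.
by case/and3P => _ _ u iL; apply: IH.
Qed.

Lemma step_norms_nth (b : base_cycle v) a : (a < period b)%N ->
  nth 0%N (step_norms b) a = Zp_norm (vertex b a.+1 - vertex b a).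
Proof. by move=> ab; rewrite (nth_map 0%N) ?size_iota // nth_iota. Qed.

Lemma size_step_norms (b : base_cycle v) : size (step_norms b) = period b.
Proof. by rewrite size_map size_iota. Qed.

Lemma mem_step_norms (b : base_cycle v) a : (a < period b)%N ->
  Zp_norm (vertex b a.+1 - vertex b a) \in step_norms b.
Proof. by move=> ab; rewrite -step_norms_nth // mem_nth ?size_step_norms. Qed.

Section System.

Variable L : seq (base_cycle v).
Hypotheses (okL : base_ok k L) (uL : uniq (norms L)).
Hypothesis fullL : {subset iota 1 v.-1./2 <= norms L}.

Let vertices (i : 'I_(size L)) := vertex (nth (base0 v) L i).
Let periods (i : 'I_(size L)) := period (nth (base0 v) L i).

Let periodic (i : 'I_(size L)) :
  periodic_cycle k (periods i) (shift (nth (base0 v) L i)) (vertices i).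
Proof. exact: okL. Qed.

Let norm_inj (i j : 'I_(size L)) a b : (a < periods i)%N -> (b < periods j)%N ->
  Zp_norm (vertices i a.+1 - vertices i a) = Zp_norm (vertices j b.+1 - vertices j b) ->
  i = j /\ a = b.
Proof.
move=> ai bj E; have ij : i = j.
  apply/val_inj/(norms_inj uL (ltn_ord i) (ltn_ord j) (mem_step_norms ai)).
  by rewrite E; apply: mem_step_norms.
subst j; split=> //; apply/eqP.
rewrite -(nth_uniq 0%N _ _ (uniq_step_norms uL (ltn_ord i))) ?size_step_norms //.
by rewrite !step_norms_nth // E.
Qed.

Let norm_onto d : (0 < d <= v.-1./2)%N -> exists (i : 'I_(size L)) a,
  (a < periods i)%N /\ Zp_norm (vertices i a.+1 - vertices i a) = d.
Proof.
move=> dV; have /fullL/flattenP[s] : d \in iota 1 v.-1./2.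
  by rewrite mem_iota; lia.
move=> /(nthP [::])[i]; rewrite size_map => iL <-; rewrite (nth_map (base0 v)) //.
move=> /mapP[a]; rewrite mem_iota => /andP[_ ai] ->.
by exists (Ordinal iL), a.
Qed.

Lemma list_system_kcycle_system : is_kcycle_system k (list_system L).
Proof. exact: (base_system_kcycle_system v_gt1 v_odd k_gt2 periodic norm_inj norm_onto). Qed.

Lemma list_system_invariant : translation_invariant (list_system L).
Proof. exact: base_system_invariant. Qed.

Lemma list_system_rigid i a e : (i < size L)%N -> e = 1 \/ e = -1 ->
  let f := vertex (nth (base0 v) L i) in
  f a.+1 = f a + e + e -> f a.+2 = f a + e -> rigid (list_system L).
Proof.
move=> iL; exact: (base_system_rigid v_gt1 v_odd k_gt2 periodic norm_inj norm_onto
  (i := Ordinal iL)).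
Qed.

End System.

Lemma edge_norm (x y x' y' : 'Z_v) :
  x != y -> [set x; y] = [set x'; y'] -> Zp_norm (y - x) = Zp_norm (y' - x').
Proof.
move=> xy E; have : x \in [set x'; y'] by rewrite -E set21.
have : y \in [set x'; y'] by rewrite -E set22.
rewrite !inE => /orP[]/eqP yE /orP[]/eqP xE; move: xy; rewrite yE xE ?eqxx //.
by rewrite -Zp_normN // opprB.
Qed.

(** A translated block keeps its differences, so a system remembers which of them lie in a common
    base cycle. This is how different systems of the family are told apart. *)
Lemma list_system_norms L L' i d1 d2 : base_ok k L -> base_ok k L' ->
    list_system L = list_system L' -> (i < size L)%N ->
    d1 \in step_norms (nth (base0 v) L i) -> d2 \in step_norms (nth (base0 v) L i) ->
  exists2 j, (j < size L')%N & d1 \in step_norms (nth (base0 v) L' j) /\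
                               d2 \in step_norms (nth (base0 v) L' j).
Proof.
move=> okL okL' E iL d1i d2i; pose b := nth (base0 v) L i.
have : edge_set k (fun a => vertex b a + 0) \in list_system L'.
  by rewrite -E; apply/imsetP; exists (Ordinal iL, 0).
case/imsetP=> -[j z] _ /= Ej; exists j => //.
have pb := okL _ iL; have pj := okL' _ (ltn_ord j); rewrite /= in pb pj.
have [mj _ _ _] := pj.
suff H d : d \in step_norms b -> d \in step_norms (nth (base0 v) L' j) by split; apply: H.
case/mapP=> a; rewrite mem_iota => /andP[_ ab] ->.
have := mem_edge_set k_gt2 (periodic_translate 0 pb) a; rewrite Ej.
case/imsetP=> c _ Ee.
have ne : vertex b a + 0 != vertex b a.+1 + 0.
  by rewrite !addr0 eq_sym; apply: (periodic_stepN0 k_gt2 pb).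
have := edge_norm ne Ee; rewrite !addr0 opprD addrACA subrr addr0 => ->.
have P (l : 'I_(size L')) : periodic_cycle k (period (nth (base0 v) L' l))
    (shift (nth (base0 v) L' l)) (vertex (nth (base0 v) L' l)) by apply: okL'.
rewrite (step_modn P j c); apply: mem_step_norms; exact: ltn_pmod.
Qed.

End ListSystem.

(** * Full orbits *)

Lemma sum_seq_const (T : eqType) (r : seq T) (F : T -> int) c :
  {in r, forall x, F x = c} -> \sum_(x <- r) F x = c * (size r)%:Z.
Proof.
elim: r => [|x r IH] Fc; first by rewrite big_nil mulr0.
rewrite big_cons IH; last by move=> y yr; apply: Fc; rewrite inE yr orbT.
rewrite Fc ?mem_head //= (_ : (size r).+1%:Z = 1 + (size r)%:Z); last by lia.
by ring.
Qed.

(** Doubling permutes the residues modulo an odd [w]; the inverse halves whichever of r and r + w is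
    even. *)
Lemma double_mod_half w h i : w.+1 = h.*2 -> (i < w)%N ->
  let r := (if (i.*2 < w)%N then i.*2 else i.*2 - w)%N in
  (if odd r then (r + w)./2 else r./2) = i.
Proof.
move=> wh iw /=; case: ltnP => wi; first by rewrite odd_double doubleK.
have ow : odd w by have := congr1 odd wh; rewrite /= odd_double => /negbFE.
by rewrite oddB // odd_double ow subnK // doubleK.
Qed.

(** The reduced double minus i is i in the first half and i - w in the second, so these values
    raised by [h] are distinct and lie between 1 and 2 h - 1. *)
Lemma double_mod_sub w h i : w.+1 = h.*2 -> (i < w)%N ->
  let c := (h + (if (i.*2 < w)%N then i.*2 else i.*2 - w) - i)%N in
  (0 < c < h.*2)%N /\ (if (h <= c)%N then (c - h)%N else (c + h).-1) = i.
Proof. by move=> wh iw /=; case: ifP => iw2; case: ifP; lia. Qed.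

Lemma neq_double_bool x (c : bool) : (2 < x)%N -> x != (2 * c)%N.
Proof. by case: c; lia. Qed.

(** * Allotting the remaining differences to n cycles *)

Section Frame.

Variables (eta tp j0 f0 b : nat) (o dl pib wrap : bool) (eps : nat -> bool).
Variables (sg sgi : nat -> nat -> nat).

Let n := (eta.*2 + o)%N.
Let M := n.*2.+1.
Let s := (tp.*2.+1 + dl)%N.
Let tq := (tp.+1 + dl)%N.
Let w := eta.*2.-1.
Let t0 := (j0.*2.+1 + pib)%N.

Hypotheses (eta_ge : (6 <= eta)%N) (tp_gt0 : (0 < tp)%N).
Hypotheses (eps0 : eps 0 = false) (epss : eps s = false).
Hypothesis t0_eq : (t0 + dl = eta + o.*2)%N.
(** In the run [tq] the eta pairs from [j0] on are broken up into 2 eta positions. The bulk cycles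
    take the w consecutive ones from [t0] on, and [b] is the one left over, at the lower or the
    upper end. *)
Hypothesis b_eq : b = if pib then j0.*2.+1 else (j0 + eta).*2.
Hypothesis f0_eq :
  (b + dl + f0.*2.+2 = n.*2 + (if wrap then o.*2.+1 else 0))%N.

Let omega := odd eta.
Let zeta := eta./2.
Let f := f0.*2.+1.

(* Run t consists of the elements el t x with x < M, cut off at x = n for
   t = s. Each cycle i < w takes the pair number sg t i of every standard run t
   (those in low, mid and high), a pair spared by the runs tp and tq, one
   further element of run tp, and closes with an element of run tq and one of
   run s. What is left makes up the cycle w and, if n is odd, the cycle w + 1.
   The parities o, dl, pib, wrap and omega only serve to make the closing
   conditions come out. *)
Definition el (t x : nat) : nat := (t * M + x)%N.

(* The J-th pair of consecutive differences in the run (t M, (t + 1) M); the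
   removed difference t M + 2 eps t displaces the pair J = 0. *)
Definition pair_pos t J : nat := (J.*2.+1 - (eps t && (J == 0%N)))%N.

(* In run 0 the elements f and 2 n are set aside as a wide pair. *)
Definition pair_pos0 J : nat := if (J < f0)%N then J.*2.+1 else J.*2.+2.

(** When [o] and [dl] hold, the pair to be broken is number [zeta] of the run [tp.+1]. The swap
    makes it slot [w.+1], which no permutation moves, and puts the last pair in its place. *)
Definition mid_swap t J : nat :=
  if [&& o, dl & t == tp.+1] then
    if J == zeta then w.+1 else if J == w.+1 then zeta else J
  else J.

Definition slot_pos t J : nat :=
  if t == 0%N then pair_pos0 J else pair_pos t (mid_swap t J).

Definition slot t J : nat := el t (slot_pos t J).

Definition spare (c : nat * nat) : nat := el c.1 (pair_pos c.1 c.2).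

(** Its elements u and u + 1 enter the cycle [w.+1] separately, one in the zigzag and one as a
    closing difference. The position solves 2 u + (sum of the signs) = s M + n. *)
Definition broken_pair : nat * nat :=
  if dl then (tp.+1, zeta) else (tp, 3 * zeta + 1 + omega)%N.

(** Chosen for their signs, which must add up to 2, 0, 1 or -1 according to [dl] and [omega]. *)
Definition extra_pairs : seq (nat * nat) :=
  if dl then
    if omega then [:: (tq, n.-1); (tq, n.-2)] else [:: (tp, n.-1); (tq, n.-1)]
  else if omega then [:: (tq, n.-1)] else [:: (tp, eta.+1)].

Definition used_pairs : seq (nat * nat) :=
  if o then if dl then extra_pairs else broken_pair :: extra_pairs else [::].

(** The pairs left whole in the runs [tp] and [tq], except pair 0 of [tp]. There are w + 2 o of
    them: one for each bulk cycle, and two to be used up when n is odd. *)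
Definition all_spare : seq (nat * nat) :=
  [seq (tp, J) | J <- iota eta.+1 (n - eta.+1)]
    ++ [seq (tq, J) | J <- iota 0 j0]
    ++ [seq (tq, J) | J <- iota (j0 + eta) (n - (j0 + eta))].

Definition spare_pairs := [seq c <- all_spare | c \notin used_pairs].

Definition low := iota 0 tp.
Definition low1 := iota 1 tp.-1.
Definition mid := iota tp.+1 dl.
Definition high := iota tq.+1 tp.-1.

(** 2 i modulo the odd number [w]. The positions 3 + i, t0 + 2 eta - 2 - 2 i and eta + 2 i - i, with
    2 i reduced, have a sum independent of i, so all the bulk cycles close together. *)
Definition twice i : nat := if (i.*2 < w)%N then i.*2 else (i.*2 - w)%N.

Definition bulk_U i := [:: el tp (3 + i)%N].
Definition bulk_P i :=
  [seq slot t (sg t i) | t <- low ++ mid ++ high]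
    ++ [:: spare (nth (0, 0)%N spare_pairs i)].
Definition bulk_K i :=
  [:: el tq (t0 + eta.*2 - 2 - twice i)%N; el s (eta + twice i - i)%N].

(** The last free parity is met by [wrap]: the element 2 eta of the run [s] either opens the zigzag,
    which then returns to 0 directly, or is the last closing difference of a cycle that passes
    through v. *)
Definition first_U :=
  let U := [:: el tp eta.+1.*2; el 0 n.*2; el 0 f] in
  if wrap then U else el s eta.*2 :: U.
Definition first_P :=
  [seq slot t w | t <- low1 ++ mid ++ high] ++ [:: spare (tp, 0%N)].
Definition first_K :=
  if wrap then [:: el tq b; el s eta.*2] else [:: el tq b].

Definition second_U := [:: spare broken_pair].
Definition second_P :=
  slot 0 w :: [seq slot t w.+1 | t <- low1 ++ high] ++ map spare extra_pairs.
Definition second_K := [:: (spare broken_pair).+1; el s n].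

Definition frame_U i :=
  if (i < w)%N then bulk_U i else if i == w then first_U else second_U.
Definition frame_P i :=
  if (i < w)%N then bulk_P i else if i == w then first_P else second_P.
Definition frame_K i :=
  if (i < w)%N then bulk_K i else if i == w then first_K else second_K.

Let v := (M * s.*2.+1)%N.

(** * Bounds on positions and the closing conditions *)

Lemma elS t x : (el t x).+1 = el t x.+1.
Proof. by rewrite /el addnS. Qed.

Lemma count_ltn_seq1 x u : count (ltn x) [:: u] = (x < u)%N.
Proof. by rewrite /= addn0. Qed.

Lemma M_le_tpM : (M <= tp * M)%N. Proof. by rewrite leq_pmull. Qed.

Lemma tq_mulM : (tq * M = tp * M + M + dl * M)%N.
Proof. by rewrite /tq; lia. Qed.

Lemma s_mulM : (s * M = tp * M + tp * M + M + dl * M)%N.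
Proof. by rewrite /s; lia. Qed.

Lemma el_ge t x c : (c <= t)%N -> (c * M <= el t x)%N.
Proof. by move=> ct; rewrite /el; have := leq_mul ct (leqnn M); lia. Qed.

Lemma el_lt t x c : (t < c)%N -> (x < M)%N -> (el t x < c * M)%N.
Proof.
move=> ct xM; rewrite /el; have := leq_mul ct (leqnn M); rewrite mulSn.
by lia.
Qed.

Lemma succ_w : w.+1 = eta.*2. Proof. by rewrite /w prednK // double_gt0; lia. Qed.

Lemma pair_pos_lt t J : (J < n)%N -> ((pair_pos t J).+1 < M)%N.
Proof. by rewrite /pair_pos /M; lia. Qed.

Lemma mid_swap_lt t J : (J < n)%N -> (mid_swap t J < n)%N.
Proof.
rewrite /mid_swap; case: and3P => // -[ho _ _] Jn.
by case: eqP => _; [|case: eqP => _ //]; move: succ_w Jn; rewrite /n /zeta ho; lia.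
Qed.

Lemma slot_pos_lt t J : (J < n - (t == 0%N))%N -> ((slot_pos t J).+1 < M)%N.
Proof.
rewrite /slot_pos; case: eqP => [_|_ Jn].
  by rewrite /pair_pos0 /M; case: ifP => _; lia.
by apply: pair_pos_lt; apply: mid_swap_lt; lia.
Qed.

Lemma slot_low t J : (t < tp)%N -> (J < n - (t == 0%N))%N -> ((slot t J).+1 < tp * M)%N.
Proof.
move=> ttp Jn; rewrite /slot elS.
by apply: el_lt => //; apply: slot_pos_lt.
Qed.

Lemma slot_low1 t J : (0 < t)%N -> (M <= slot t J)%N.
Proof. by move=> t0'; rewrite -[X in (X <= _)%N]mul1n; apply: el_ge. Qed.

Lemma slot_high t J : (tp < t)%N -> (tp.+1 * M <= slot t J)%N.
Proof. by move=> tt; apply: el_ge. Qed.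

Lemma mem_all_spare c : c \in all_spare ->
  (c.1 = tp /\ (eta < c.2 < n)%N) \/
  (c.1 = tq /\ ((c.2 < j0)%N \/ (j0 + eta <= c.2 < n)%N)).
Proof.
rewrite !mem_cat => /or3P[]/mapP[J]; rewrite mem_iota => hJ -> /=.
- by left; split=> //; lia.
- by right; split=> //; left; lia.
- by right; split=> //; right; lia.
Qed.

Lemma all_spareE t J : (t, J) \in all_spare =
  (t == tp) && (eta < J < n)%N || (t == tq) && ((J < j0) || (j0 + eta <= J < n))%N.
Proof.
have memE a lo len : ((t, J) \in [seq (a, J') | J' <- iota lo len]) =
    (t == a) && (lo <= J < lo + len)%N.
  apply/mapP/andP => [[J' + [-> ->]]|[/eqP -> h]]; rewrite ?mem_iota ?eqxx //.
  by exists J; rewrite // mem_iota.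
rewrite !mem_cat !memE; case: (t == tp); case: (t == tq); rewrite /= ?orbF //.
- by lia.
- by lia.
- by lia.
Qed.

Lemma uniq_all_spare : uniq all_spare.
Proof.
have inj a : injective (pair a : nat -> nat * nat) by move=> x y [].
rewrite !cat_uniq !(map_inj_uniq (inj _)) !iota_uniq /= andbT.
apply/andP; split; apply/hasPn => c.
  rewrite mem_cat => /orP[]/mapP[J _ ->]; apply/negP => /mapP[J' _ []]; rewrite /tq; lia.
move=> /mapP[J]; rewrite mem_iota => hJ ->; apply/negP => /mapP[J'].
by rewrite mem_iota => hJ' [] JJ'; lia.
Qed.

Lemma size_all_spare : size all_spare = (w + o.*2)%N.
Proof. by rewrite !size_cat !size_map !size_iota; move: succ_w; lia. Qed.

Lemma omega_zeta : eta = (omega + zeta.*2)%N.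
Proof. by rewrite /omega /zeta odd_double_half. Qed.

Lemma used_sub : {subset used_pairs <= all_spare}.
Proof.
have [z3 nE] : (3 <= zeta)%N /\ n = (omega.*2 + zeta.*2.*2 + o)%N.
  by move: omega_zeta; rewrite /n; lia.
move=> [t J]; rewrite all_spareE /used_pairs /broken_pair /extra_pairs.
case ho: o; case hd: dl => //=; rewrite ?inE.
- by case hw : omega; rewrite !inE => /orP[]/eqP[-> ->]; rewrite ?eqxx /=; lia.
- by case hw : omega; rewrite !inE => /orP[]/eqP[-> ->]; rewrite ?eqxx /=; lia.
Qed.

Lemma size_spare_pairs : size spare_pairs = w.
Proof.
have uu : uniq used_pairs.
  rewrite /used_pairs /broken_pair /extra_pairs; case: o; case: dl => //=.
    by case: omega; rewrite /= inE !xpair_eqE; lia.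
  by case: omega; rewrite /= inE !xpair_eqE; lia.
have := count_predC (mem used_pairs) all_spare; rewrite size_all_spare.
have -> : count (mem used_pairs) all_spare = o.*2%N.
  rewrite -size_filter (@perm_size _ _ used_pairs).
    by rewrite /used_pairs /extra_pairs; case: o; case: dl => //; case: omega.
  apply: uniq_perm => //; first exact: filter_uniq uniq_all_spare.
  move=> c; rewrite mem_filter andb_idr //; exact: used_sub.
by rewrite size_filter (@eq_count _ _ (predC (mem used_pairs))) //; lia.
Qed.

Lemma mem_spare i : (i < w)%N -> nth (0, 0)%N spare_pairs i \in spare_pairs.
Proof. by move=> iw; apply: mem_nth; rewrite size_spare_pairs. Qed.

Lemma spare_all c : c \in spare_pairs -> c \in all_spare.
Proof. by rewrite mem_filter => /andP[]. Qed.

Hypothesis sg_lt : forall t i, (i < w)%N -> (sg t i < w)%N.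
Hypothesis sgK : forall t i, (i < w)%N -> sgi t (sg t i) = i.

Lemma slot_low_lt t J : t \in low -> (J < w + o)%N -> (slot t J < tp * M)%N.
Proof.
rewrite mem_iota add0n => /andP[_ ttp] Jw; apply: ltnW (slot_low ttp _).
by move: succ_w; rewrite /n; case: (t == 0%N); lia.
Qed.

Lemma slot_low1_lt t J : t \in low1 -> (J < n)%N -> (M <= slot t J < tp * M)%N.
Proof.
rewrite mem_iota => tt Jn; rewrite slot_low1; last by lia.
apply: ltnW (slot_low _ _); first by lia.
by case: eqP; lia.
Qed.

Lemma slot_mid_ge t J : t \in mid -> (tp * M + M <= slot t J)%N.
Proof.
rewrite mem_iota => /andP[tt _]; apply: leq_trans (slot_high J tt).
by rewrite mulSn addnC.
Qed.

Lemma slot_high_ge t J : t \in high -> (tp * M + M <= slot t J)%N.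
Proof.
rewrite mem_iota => /andP[tt _]; apply: leq_trans (slot_high J _); last first.
  by apply: leq_ltn_trans tt; rewrite /tq; lia.
by rewrite mulSn addnC.
Qed.

Lemma slot_lt_s t J : t \in low1 ++ mid ++ high -> (J < n)%N -> (slot t J < s * M)%N.
Proof.
move=> tr Jn; have ts : (0 < t < s)%N.
  by move: tr; rewrite !mem_cat !mem_iota /s /tq; case: (dl) => /=; lia.
apply: el_lt; first by lia.
by apply: ltnW (slot_pos_lt _); rewrite (_ : (t == 0%N) = false); lia.
Qed.

Lemma v_eq : v = (s * M + s * M + M)%N.
Proof. by rewrite /v mulnS -addnn mulnDr ![(M * _)%N]mulnC addnC. Qed.

(** The tp low pairs count -1, while the dl + tp - 1 pairs of the middle and high runs and the spare
    pair count 1, a total of dl. As tp + tq = s, the equation becomes [t0_eq]. *)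
Lemma bulk_closing i : (i < w)%N -> closing v (bulk_U i) (bulk_P i) (bulk_K i).
Proof.
move=> iw; split=> //.
have tw : (twice i + i <= 2 * w.-1)%N by rewrite /twice; case: ifP; lia.
have tw2 : (twice i < w)%N by rewrite /twice; case: ifP; lia.
have itw : (i <= eta + twice i)%N by rewrite /twice; move: succ_w; case: ifP; lia.
have cU x : count (ltn x) (bulk_U i) = (x < el tp (3 + i))%N by apply: count_ltn_seq1.
rewrite /bulk_P big_cat big_map !big_cat big_seq1 cU.
rewrite (sum_seq_const (c := -1)); last first.
  move=> t tl; rewrite cU /el (leq_trans (slot_low_lt tl _)) //.
    exact: ltn_addr (sg_lt t iw).
  exact: leq_addr.
rewrite (sum_seq_const (c := 1)); last first.
  move=> t tl; rewrite cU ltnNge (leq_trans _ (slot_mid_ge _ tl)) //.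
  by rewrite /el leq_add2l; move: succ_w; rewrite /M /n; lia.
rewrite (sum_seq_const (c := 1)); last first.
  move=> t tl; rewrite cU ltnNge (leq_trans _ (slot_high_ge _ tl)) //.
  by rewrite /el leq_add2l; move: succ_w; rewrite /M /n; lia.
rewrite !size_iota /spare.
have [t [J [-> tJ]]] : exists t J, nth (0, 0)%N spare_pairs i = (t, J) /\
    ((t = tp /\ eta < J) \/ t = tq)%N.
  have := mem_all_spare (spare_all (mem_spare iw)); case: nth => t J /= h.
  by exists t, J; split=> //; case: h => [[-> /andP[]]|[-> _]]; [left|right].
have -> : (el t (pair_pos t J) < el tp (3 + i))%N = false.
  apply/negbTE; rewrite -leqNgt; case: tJ => [[-> eJ]|->]; rewrite /el /pair_pos.
    by rewrite leq_add2l; move: succ_w; lia.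
  by rewrite tq_mulM; move: succ_w; rewrite /M /n; lia.
have -> : alt (desc (bulk_U i)) = el tp (3 + i) by rewrite /bulk_U /alt /= subr0.
rewrite expr0 /el v_eq tq_mulM s_mulM; move: succ_w t0_eq itw tw2.
move: (tp * M)%N (dl * M)%N => A B; rewrite /M /n /=; clear -tp_gt0.
by move: w t0 (twice i) => w' t' r; case: (dl) => /=; lia.
Qed.

Lemma f0_lt : (f0 < n)%N.
Proof.
move: f0_eq succ_w t0_eq; rewrite b_eq /n /t0; clear -eta_ge; move: (w) => w'.
by case: (pib); case: (wrap); case: (dl); lia. Qed.

(** The wide pair lies below every other difference of the cycle, so it affects no sign and
    contributes 2 n - f up to sign. The value of [f0] given by [f0_eq] makes the sum right. *)
Lemma first_closing : closing v first_U first_P first_K.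
Proof.
have w_lt_n : (w < n)%N by move: succ_w; rewrite /n; lia.
have nM : (n.*2 < M)%N by rewrite /M.
have aM : (eta.+1.*2 < M)%N by rewrite /M /n; lia.
have fE : f = f0.*2.+1 by [].
have ff : (f <= n.*2)%N by move: f0_lt; rewrite fE; clear; move: (n); lia.
have e0 x : el 0 x = x by rewrite /el mul0n.
have count_lt x y z : (z < y)%N -> (y < x)%N -> count (ltn x) [:: el tp eta.+1.*2; y; z] =
    (x < el tp eta.+1.*2)%N.
  by move=> zy yx; rewrite /= !addn0; lia.
have count3 x : (n.*2 < x)%N -> count (ltn x) [:: el tp eta.+1.*2; el 0 n.*2; el 0 f] =
    (x < el tp eta.+1.*2)%N.
  by rewrite !e0 => nx; apply: count_lt => //; move: f0_lt; rewrite fE; clear; move: (n); lia.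
have lo t : t \in low1 -> (n.*2 < slot t w < el tp eta.+1.*2)%N.
  move=> tl; have /andP[h1 h2] := slot_low1_lt tl w_lt_n.
  by rewrite (leq_trans _ h1) //= (leq_trans h2) // leq_addr.
have hi t : t \in mid ++ high -> (n.*2 < slot t w)%N /\ (el tp eta.+1.*2 < slot t w < s * M)%N.
  move=> tl; have h1 : (tp * M + M <= slot t w)%N.
    by move: tl; rewrite mem_cat => /orP[/slot_mid_ge|/slot_high_ge].
  have h2 : (slot t w < s * M)%N by apply: slot_lt_s => //; rewrite mem_cat tl orbT.
  by rewrite h2 andbT; split; [|rewrite /el]; lia.
have fst : (n.*2 < spare (tp, 0%N) < el tp eta.+1.*2)%N.
  by move: M_le_tpM; rewrite /spare /el /pair_pos /=; lia.
have aS : (el tp eta.+1.*2 < s * M)%N by rewrite s_mulM /el; lia.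
have SM : (n.*2 < el s eta.*2)%N by rewrite /el; lia.
rewrite /closing /first_U /first_K; case hw : wrap.
  split=> //; rewrite (@desc_eq _ [:: el tp eta.+1.*2; el 0 n.*2; el 0 f]) //; last first.
    rewrite /= !e0 andbT; apply/andP; split; first by move: M_le_tpM; rewrite /el; lia.
    exact: ff.
  have cU := count3; rewrite /first_P big_cat big_map !big_cat big_seq1.
  rewrite (sum_seq_const (c := -1)); last first.
    by move=> t /lo/andP[h1 h2]; rewrite cU // h2.
  rewrite (sum_seq_const (c := 1)); last first.
    move=> t tl; have [|h1 /andP[h2 _]] := hi t; first by rewrite mem_cat tl.
    by rewrite cU // ltnNge ltnW.
  rewrite (sum_seq_const (c := 1)); last first.
    move=> t tl; have [|h1 /andP[h2 _]] := hi t; first by rewrite mem_cat tl orbT.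
    by rewrite cU // ltnNge ltnW.
  have /andP[h1 h2] := fst; rewrite cU // h2 !size_iota /= !e0.
  rewrite v_eq /el tq_mulM s_mulM; move: succ_w t0_eq f0_eq b_eq fE; rewrite hw.
  move: (tp * M)%N (dl * M)%N => A B; rewrite /M /n /t0 /=; clear -tp_gt0.
  by case: (pib); case: (dl) => /=; lia.
split=> //; set U3 := [:: _; _; _].
rewrite (@desc_eq _ (el s eta.*2 :: U3)) //; last first.
  rewrite /= !e0 andbT; apply/and3P; split.
  - by apply: leq_trans (leq_addr _ _); apply: ltnW.
  - by move: M_le_tpM; rewrite /el; lia.
  - exact: ff.
have cU x : (n.*2 < x)%N -> count (ltn x) (el s eta.*2 :: U3) =
    ((x < el s eta.*2) + (x < el tp eta.+1.*2))%N.
  by move=> nx; rewrite -(count3 x nx).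
have ltS x : (x < s * M)%N -> (x < el s eta.*2)%N.
  by move=> h; apply: leq_trans h (leq_addr _ _).
rewrite /first_P big_cat big_map !big_cat big_seq1.
rewrite (sum_seq_const (c := 1)); last first.
  move=> t /lo/andP[h1 h2]; rewrite cU // h2 ltS // (leq_trans _ (ltnW aS)) //.
rewrite (sum_seq_const (c := -1)); last first.
  move=> t tl; have [|h1 /andP[h2 h3]] := hi t; first by rewrite mem_cat tl.
  by rewrite cU // (ltS _ h3) ltnNge ltnW.
rewrite (sum_seq_const (c := -1)); last first.
  move=> t tl; have [|h1 /andP[h2 h3]] := hi t; first by rewrite mem_cat tl orbT.
  by rewrite cU // (ltS _ h3) ltnNge ltnW.
have /andP[h1 h2] := fst; rewrite cU // h2 ltS; last exact: ltn_trans h2 aS.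
rewrite !size_iota /= !e0.
rewrite /el tq_mulM s_mulM; move: succ_w t0_eq f0_eq b_eq fE; rewrite hw.
move: (tp * M)%N (dl * M)%N => A B; rewrite /M /n /t0 /=; clear -tp_gt0.
by case: (pib); case: (dl) => /=; lia.
Qed.

Lemma zeta_ge : (3 <= zeta)%N.
Proof. by rewrite /zeta; lia. Qed.

Lemma second_closing : o -> closing v second_U second_P second_K.
Proof.
move=> ho; split=> //.
have n_eq : n = (omega.*2 + zeta.*2.*2 + 1)%N.
  by rewrite /n ho {1}omega_zeta doubleD.
have w_pn : (w.+1 = n.-1)%N by move: succ_w; rewrite /n ho; lia.
set u := spare broken_pair; have uE : u =
    (tp * M + if dl then M + zeta.*2.+1 else (3 * zeta + 1 + omega).*2.+1)%N.
  rewrite /u /broken_pair /spare /pair_pos; case: (dl) => /=; rewrite /el.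
    by rewrite (_ : (zeta == 0%N) = false) ?andbF ?subn0; lia.
  by rewrite (_ : (_ == 0%N) = false) ?andbF ?subn0; lia.
have cU x : count (ltn x) second_U = (x < u)%N by apply: count_ltn_seq1.
have u_lt : (tp * M <= u < tp * M + M + dl * M)%N.
  rewrite uE leq_addr /= -!addnA ltn_add2l; move: zeta_ge; rewrite n_eq in w_pn.
  by case: (dl) => /=; rewrite /M n_eq; case: (omega) => /=; lia.
have frag t J : (J < n)%N -> (t == tp) && (J.*2.+1 < u - tp * M)%N || (t == tq) ->
    (0 < J)%N -> (spare (t, J) < u)%N = (t == tp).
  move=> Jn + J0; rewrite /spare /pair_pos /= (gtn_eqF J0) andbF subn0.
  case/orP => [/andP[/eqP-> h]|/eqP ->].
    by rewrite eqxx /el; lia.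
  rewrite /el tq_mulM (_ : (tq == tp) = false); last by rewrite /tq; lia.
  by apply/negbTE; rewrite -leqNgt; case/andP: u_lt; lia.
have h0 : (slot 0 w < u)%N.
  apply: leq_trans (slot_low_lt _ _) _; first by rewrite mem_iota tp_gt0.
    by rewrite ho addn1.
  by case/andP: u_lt.
rewrite /second_P big_cons big_cat !big_map !big_cat cU h0.
rewrite (sum_seq_const (c := -1)); last first.
  move=> t tl; rewrite cU; have /andP[_ h] : (M <= slot t w.+1 < tp * M)%N.
    by apply: slot_low1_lt => //; rewrite w_pn; lia.
  by rewrite (leq_trans h) //; case/andP: u_lt.
rewrite (sum_seq_const (c := 1)); last first.
  move=> t; rewrite mem_iota => /andP[tt _]; rewrite cU ltnNge ltnW //.
  have := el_ge (slot_pos t w.+1) tt; rewrite -/(slot _ _) mulSn tq_mulM.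
  by case/andP: u_lt; lia.
rewrite !size_iota /second_K.
have -> : \sum_(x <- extra_pairs) (-1) ^+ count (ltn (spare x)) second_U =
    (if dl then if omega then 2 else 0 else if omega then 1 else -1 : int).
  rewrite /extra_pairs; have eta_lt : (eta.+1 < n)%N by rewrite /n; lia.
  have uD : (u - tp * M = if dl then M + zeta.*2.+1 else (3 * zeta + 1 + omega).*2.+1)%N.
    by rewrite uE addKn.
  case hd : (dl); rewrite hd in uD; case hw : (omega); rewrite ?hw in uD.
  - rewrite !big_cons big_nil !cU !frag ?eqxx ?orbT //; try lia.
    by rewrite /tq (_ : (tp.+1 + dl == tp)%N = false) //; lia.
  - rewrite !big_cons big_nil !cU !frag ?eqxx ?orbT //; try lia.
    by rewrite /tq (_ : (tp.+1 + dl == tp)%N = false) //; lia.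
  - rewrite big_seq1 cU frag ?eqxx ?orbT //; try lia.
    by rewrite /tq (_ : (tp.+1 + dl == tp)%N = false) //; lia.
  - rewrite big_seq1 cU frag ?eqxx //=; apply/orP; left.
    by rewrite uD; move: omega_zeta; rewrite hw; lia.
rewrite /= -/u subr0 !uE v_eq /el s_mulM.
move: (tp * M)%N => A; rewrite /M n_eq.
by case: (dl); case: (omega) => /=; lia.
Qed.

(** * Disjointness of the cycles *)

Definition owner_slot t J := if (J < w)%N then sgi t J else J.

Definition owner_spare c := if c \in used_pairs then w.+1 else index c spare_pairs.

(** Decodes a position into the cycle that takes it, so disjointness amounts to checking that the
    elements of cycle i decode to i. That every difference is taken follows later by counting. *)
Definition owner t x : nat :=
  let J := (x.-1)./2 in
  if t == s then
    if x == eta.*2 then w else if x == n then w.+1 else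
    if (eta <= x)%N then (x - eta)%N else (x + eta).-1
  else if t == tp then
    if J == 0%N then w else if (J <= eta)%N then (x - 3)%N else owner_spare (tp, J)
  else if t == tq then
    if (j0 <= J < j0 + eta)%N then
      if x == b then w else
      let c := (t0 + eta.*2 - 2 - x)%N in
      if odd c then (c + w)./2 else c./2
    else owner_spare (tq, J)
  else if t == 0%N then
    if (x == n.*2) || (x == f) then w else
    let J := if (x < f)%N then J else (x - 2)./2 in
    if (J < w)%N then sgi 0 J else w.+1
  else owner_slot t (mid_swap t J).

Definition valid_pos t x : bool :=
  if t == s then (0 < x <= n)%N
  else (t < s)%N && (if t == 0%N then (0 < x)%N else x != (2 * eps t)%N).

Definition owned i x :=
  exists t y, [/\ x = el t y, (y < M)%N, owner t y = i & valid_pos t y].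

Lemma owned_unique i j x : owned i x -> owned j x -> i = j.
Proof.
case=> t [y [-> yM <- _]] [t' [y' [E yM' <- _]]].
have /= := congr1 (fun z => (z %/ M)%N) E; rewrite !divnMDl // !divn_small // !addn0 => tt'.
by move: E; rewrite /el tt' => /addnI ->.
Qed.

Lemma el_div t x : (x < M)%N -> (el t x %/ M)%N = t.
Proof. by move=> xM; rewrite /el divnMDl // divn_small // addn0. Qed.

Lemma mid_swapK t J : mid_swap t (mid_swap t J) = J.
Proof.
have wz : (zeta == w.+1) = false by rewrite /zeta; move: succ_w; lia.
rewrite /mid_swap; case: and3P => // _; case: (J =P zeta) => [->|Jz].
  by rewrite eq_sym wz eqxx.
by case: (J =P w.+1) => [->|Jw]; [rewrite eqxx|case: eqP => // _; case: eqP].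
Qed.

(** Since the predecessor of 0 is 0, [(x.-1)./2] gives back J also for the displaced pair at the
    positions 0 and 1. *)
Lemma owned_pair i t J : (0 < t < s)%N -> (J < n)%N ->
    (forall x, (x.-1)./2 = J -> (0 < J -> 2 < x)%N -> owner t x = i) ->
  owned i (el t (pair_pos t J)) /\ owned i (el t (pair_pos t J)).+1.
Proof.
move=> ts Jn own; have Jlt := pair_pos_lt t Jn.
have t_s : (t == s) = false by lia.
have t_0 : (t == 0%N) = false by lia.
rewrite elS; split; exists t; eexists; split; try reflexivity.
- exact: ltnW.
- by apply: own; rewrite /pair_pos; clear; case: (J =P 0%N) => [->|]; case: (eps t); lia.
- rewrite /valid_pos t_s t_0 /pair_pos; move: ts; clear; move: (s) => s'.
  by case: (J =P 0%N) => [->|]; case: (eps t); lia.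
- exact: Jlt.
- by apply: own; rewrite /pair_pos; clear; case: (J =P 0%N) => [->|]; case: (eps t); lia.
- rewrite /valid_pos t_s t_0 /pair_pos; move: ts; clear; move: (s) => s'.
  by case: (J =P 0%N) => [->|]; case: (eps t); lia.
Qed.

Lemma owned_slot i t J : t \in low1 ++ mid ++ high -> (J < n)%N ->
  owner_slot t J = i -> owned i (slot t J) /\ owned i (slot t J).+1.
Proof.
move=> tr Jn oJ; have [ts tpN tqN] : [/\ (0 < t < s)%N, (t == tp) = false & (t == tq) = false].
  by move: tr; rewrite !mem_cat !mem_iota /s /tq; case: (dl) => /=; split; lia.
have t_s : (t == s) = false by lia.
have t_0 : (t == 0%N) = false by lia.
rewrite /slot /slot_pos t_0; apply: owned_pair => //; first exact: mid_swap_lt.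
by move=> x Jx _; rewrite /owner t_s tpN tqN t_0 Jx mid_swapK.
Qed.

Lemma owned_slot0 i J : (J < n.-1)%N -> (if (J < w)%N then sgi 0 J else w.+1) = i ->
  owned i (slot 0 J) /\ owned i (slot 0 J).+1.
Proof.
move=> Jn oJ.
have [t_s tpN tqN] :
    [/\ (0 == s)%N = false, (0 == tp)%N = false & (0 == tq)%N = false].
  by rewrite /s /tq; split; lia.
have fn : (f < n.*2)%N by move: f0_lt; rewrite /f; lia.
have sM' := slot_pos_lt (t := 0%N) (J := J); rewrite eqxx subn1 in sM'.
have own x : (0 < x < n.*2)%N -> x != f ->
    (if (x < f)%N then x.-1./2 else (x - 2)./2) = J -> owner 0 x = i.
  move=> xn xf xJ; rewrite /owner t_s tpN tqN eqxx xJ (negPf xf) orbF ifF //.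
  by apply/negbTE; lia.
have vp x : (0 < x)%N -> valid_pos 0 x by move=> x0; rewrite /valid_pos t_s eqxx x0 /s; lia.
have pos : slot_pos 0 J = if (J < f0)%N then J.*2.+1 else J.*2.+2.
  by rewrite /slot_pos eqxx.
rewrite /slot elS; split; exists 0%N; eexists; split; try reflexivity.
- by apply: ltnW; apply: sM'.
- rewrite pos; case: ltnP => Jf; apply: own; move: Jn Jf f0_lt; rewrite /f; clear;
    by move: (n) => n'; try case: ifP; lia.
- by apply: vp; rewrite pos; case: ifP.
- exact: sM'.
- rewrite pos; case: ltnP => Jf; apply: own; move: Jn Jf f0_lt; rewrite /f; clear;
    by move: (n) => n'; try case: ifP; lia.
Qed.

Lemma tp_neq_s : (tp == s) = false. Proof. by rewrite /s; lia. Qed.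
Lemma tq_neq_s : (tq == s) = false. Proof. by rewrite /s /tq; lia. Qed.
Lemma tq_neq_tp : (tq == tp) = false. Proof. by rewrite /tq; lia. Qed.

Lemma owned_spare i c : c \in all_spare -> owner_spare c = i ->
  owned i (spare c) /\ owned i (spare c).+1.
Proof.
case: c => t J /mem_all_spare /= h oc; rewrite /spare /=.
have tts : (0 < t < s)%N by case: h => -[-> _]; rewrite /s /tq; lia.
have Jn : (J < n)%N by move: succ_w t0_eq; rewrite /n; case: h => -[_]; lia.
apply: owned_pair => // x Jx _; rewrite /owner Jx.
case: h => -[tE hJ]; rewrite tE in oc *.
  by rewrite tp_neq_s eqxx ifF ?ifF //; lia.
by rewrite tq_neq_s tq_neq_tp eqxx ifF //; lia.
Qed.

Lemma uniq_spare_pairs : uniq spare_pairs.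
Proof. exact: filter_uniq uniq_all_spare. Qed.

Lemma owned_pairs i P : {in P, forall x, owned i x /\ owned i x.+1} ->
  {in pairs P, forall x, owned i x}.
Proof.
move=> h x; rewrite mem_pairs => /orP[/h[]//|/andP[x0 /h[_]]].
by rewrite prednK.
Qed.

Lemma t0_ge : (5 <= t0)%N. Proof. by lia. Qed.

Lemma t0_le : (t0 + eta.*2 <= n.*2)%N.
Proof. by rewrite /n; lia. Qed.

Lemma valid_block t x : (0 < t < s)%N -> (2 < x)%N -> valid_pos t x.
Proof.
move=> /andP[t_gt0 ts] x2; rewrite /valid_pos ts (ltn_eqF ts) (gtn_eqF t_gt0).
exact: neq_double_bool.
Qed.

Lemma tp_range : (0 < tp < s)%N. Proof. by rewrite /s; lia. Qed.
Lemma tq_range : (0 < tq < s)%N. Proof. by rewrite /s /tq; lia. Qed.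
Lemma eta_lt_M : (eta.*2.+2 < M)%N. Proof. by rewrite /M /n; lia. Qed.
Lemma t0_lt_M : (t0 + eta.*2 < M)%N. Proof. by move: t0_le; rewrite /M; lia. Qed.
Lemma w_lt_n : (w < n)%N. Proof. by move: succ_w; rewrite /n; lia. Qed.
Lemma w_le_n : (w + o <= n.-1)%N. Proof. by move: succ_w; rewrite /n; lia. Qed.

Lemma owned_p x : (x <= w)%N -> owned x (el tp (3 + x)%N).
Proof.
move=> xw; have x_eta : (0 < (3 + x).-1./2 <= eta)%N by move: succ_w; clear -xw; lia.
exists tp, (3 + x)%N; split=> //.
- by apply: leq_trans eta_lt_M; move: succ_w; clear -xw; lia.
- rewrite /owner tp_neq_s eqxx; case/andP: x_eta => x0 ->.
  by rewrite (gtn_eqF x0) addKn.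
- exact: (valid_block tp_range).
Qed.

Lemma twice_lt i : (i < w)%N -> (twice i < w)%N.
Proof. by rewrite /twice; clear; case: ifP; lia. Qed.

Lemma b_notin r : (r < w)%N -> (t0 + eta.*2 - 2 - r == b)%N = false.
Proof.
by move=> rw; move: succ_w; rewrite b_eq /t0; clear -rw; case: (pib) => /=; lia.
Qed.

Lemma q_block r : (r < w)%N -> (j0 <= (t0 + eta.*2 - 2 - r).-1./2 < j0 + eta)%N.
Proof.
by move=> rw; move: succ_w; rewrite /t0; clear -rw; case: (pib) => /=; lia.
Qed.

Lemma bulk_owned i : (i < w)%N ->
  {in (bulk_U i ++ pairs (bulk_P i)) ++ bulk_K i, forall x, owned i x}.
Proof.
move=> iw x; rewrite !mem_cat !inE -orbA => /or4P[/eqP->|xP|/eqP->|/eqP->].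
- exact: owned_p (ltnW iw).
- move: x xP; apply: owned_pairs => x; rewrite mem_cat inE.
  case/orP => [/mapP[t tr ->]|/eqP->].
    have sgw := sg_lt t iw.
    have os : owner_slot t (sg t i) = i by rewrite /owner_slot sgw sgK.
    case: (posnP t) => [t0'|t_gt0]; last first.
      apply: owned_slot os; last exact: ltn_trans sgw w_lt_n.
      move: tr; rewrite !mem_cat => /orP[|->]; last by rewrite orbT.
      rewrite !mem_iota t_gt0 add0n /= => ttp; apply/orP; left.
      by rewrite add1n prednK.
    subst t; apply: owned_slot0; last by rewrite sgw sgK.
    by apply: leq_trans sgw (leq_trans _ w_le_n); apply: leq_addr.
  have cs := mem_spare iw; apply: owned_spare; first exact: spare_all.
  move: (cs); rewrite mem_filter /owner_spare => /andP[/negbTE -> _].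
  by rewrite index_uniq ?size_spare_pairs ?uniq_spare_pairs.
- have rw := twice_lt iw.
  have le_r : (twice i <= t0 + eta.*2 - 2)%N.
    by move: rw succ_w t0_ge; clear; move: (twice i) (t0) => ? ?; lia.
  exists tq; eexists; split; try reflexivity.
  + by apply: leq_ltn_trans t0_lt_M; rewrite -subnDA leq_subr.
  + rewrite /owner tq_neq_s tq_neq_tp eqxx q_block // b_notin // subKn //.
    exact: (double_mod_half succ_w iw).
  + apply: (valid_block tq_range); move: rw succ_w t0_ge; clear.
    by move: (twice i) (t0) => ? ?; lia.
- have [xn xi] := double_mod_sub succ_w iw.
  exists s; eexists; split; try reflexivity.
  + by apply: ltn_trans eta_lt_M; case/andP: xn => _ h; apply: ltn_trans h _.
  + have x1 : (eta + twice i - i == eta.*2)%N = false by apply: ltn_eqF; case/andP: xn.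
    have x2 : (eta + twice i - i == n)%N = false.
      by apply: ltn_eqF; apply: leq_trans (leq_addr _ _); case/andP: xn.
    by rewrite /owner eqxx x1 x2.
  + rewrite /valid_pos eqxx; case/andP: xn => -> h /=.
    by apply: leq_trans (ltnW h) (leq_addr _ _).
Qed.

Lemma owned_block_b : owned w (el tq b).
Proof.
have bJ : [/\ (j0 <= b.-1./2 < j0 + eta)%N, (2 < b)%N & (b < M)%N].
  have : (b <= t0 + eta.*2)%N.
    by rewrite b_eq /t0; clear; case: (pib) => /=; lia.
  move=> bt; split; last exact: leq_ltn_trans bt t0_lt_M.
    by rewrite b_eq; clear -eta_ge; case: (pib); lia.
  by move: t0_ge; rewrite b_eq /t0; clear -eta_ge; case: (pib) => /=; lia.
case: bJ => bJ b2 bM; exists tq, b; split=> //.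
  by rewrite /owner tq_neq_s tq_neq_tp eqxx bJ eqxx.
exact: valid_block tq_range b2.
Qed.

Lemma owned_run0 x : x = n.*2 \/ x = f -> owned w (el 0 x).
Proof.
move=> hx; have fn : (0 < f < n.*2)%N.
  by rewrite /f /= -addn1 -[n.*2]addn0; move: f0_lt; clear; move: (n) => ?; lia.
have x0 : (0 < x <= n.*2)%N by case: hx => ->; move: fn; clear; move: (n) (f) => ? ?; lia.
have s0 : (0%N == s) = false by rewrite eq_sym /s addSn.
have tp0 : (0%N == tp) = false by rewrite eq_sym (gtn_eqF tp_gt0).
exists 0%N, x; split=> //.
- by rewrite /M ltnS; case/andP: x0.
- rewrite /owner s0 tp0 (_ : (0%N == tq) = false) // eqxx.
  by case: hx => ->; rewrite eqxx ?orbT.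
- by rewrite /valid_pos s0 eqxx /s addSn; case/andP: x0.
Qed.

Lemma owned_first_z : owned w (el s eta.*2).
Proof.
exists s, eta.*2; split=> //; first by apply: ltn_trans eta_lt_M.
  by rewrite /owner !eqxx.
by rewrite /valid_pos eqxx double_gt0 (leq_trans _ eta_ge) //= leq_addr.
Qed.

Lemma first_owned :
  {in (first_U ++ pairs first_P) ++ first_K, forall x, owned w x}.
Proof.
have oa : owned w (el tp eta.+1.*2).
  have := owned_p (leqnn w).
  by rewrite (_ : (3 + w = eta.+1.*2)%N) //; move: succ_w; clear; lia.
have oP : {in pairs first_P, forall x, owned w x}.
  apply: owned_pairs => x; rewrite mem_cat inE => /orP[/mapP[t tr ->]|/eqP->].
    by apply: (owned_slot tr w_lt_n); rewrite /owner_slot ltnn.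
  apply: (owned_pair tp_range (leq_ltn_trans (leq0n w) w_lt_n)) => x' J0 _.
  by rewrite /owner tp_neq_s eqxx J0.
move=> x; rewrite !mem_cat -orbA => /or3P[|/oP //|].
  have h3 y : y \in [:: el tp eta.+1.*2; el 0 n.*2; el 0 f] -> owned w y.
    rewrite !inE => /or3P[]/eqP-> //; apply: owned_run0; [by left|by right].
  rewrite /first_U; case: wrap; first exact: h3.
  by rewrite inE => /orP[/eqP->|/h3 //]; apply: owned_first_z.
rewrite /first_K; case: wrap; rewrite !inE; [case/orP|]; move/eqP->;
  by [exact: owned_block_b|exact: owned_first_z].
Qed.

Lemma second_owned : o ->
  {in (second_U ++ pairs second_P) ++ second_K, forall x, owned w.+1 x}.
Proof.
move=> ho; have wo : (w.+1 < n)%N by rewrite succ_w /n ho addn1.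
have os t : owner_slot t w.+1 = w.+1 by rewrite /owner_slot ltnNge leqnSn.
have ex : {in extra_pairs, forall c, owned w.+1 (spare c) /\ owned w.+1 (spare c).+1}.
  move=> c ce; have cu : c \in used_pairs.
    by rewrite /used_pairs ho; case: dl; rewrite ?inE ce ?orbT.
  by apply: owned_spare; [exact: used_sub|rewrite /owner_spare cu].
have br : owned w.+1 (spare broken_pair) /\ owned w.+1 (spare broken_pair).+1.
  case hd : (dl); last first.
    have cu : broken_pair \in used_pairs by rewrite /used_pairs ho hd mem_head.
    by apply: owned_spare; [exact: used_sub|rewrite /owner_spare cu].
  have -> : spare broken_pair = slot tp.+1 w.+1.
    rewrite /spare /broken_pair hd /slot /slot_pos /mid_swap ho hd eqxx /=.
    by rewrite ifF ?eqxx // /zeta; apply: gtn_eqF; move: succ_w eta_ge; clear; lia.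
  apply: (owned_slot _ wo (os _)).
  by rewrite /mid hd !mem_cat mem_iota addn1 leqnn ltnSn orbT.
have oP : {in pairs second_P, forall x, owned w.+1 x}.
  apply: owned_pairs => x; rewrite inE mem_cat => /or3P[/eqP->|/mapP[t tr ->]|/mapP[c ce ->]].
  - apply: owned_slot0; last by rewrite ltnn.
    by apply: leq_trans w_le_n; rewrite ho addn1.
  - apply: (owned_slot _ wo (os _)); move: tr; rewrite !mem_cat.
    by case/orP=> ->; rewrite ?orbT.
  - exact: ex.
have oz : owned w.+1 (el s n).
  exists s, n; split=> //; first by rewrite /M; clear; move: (n) => ?; lia.
    rewrite /owner !eqxx ifF //; apply: gtn_eqF; by rewrite /n ho addn1.
  by rewrite /valid_pos eqxx leqnn andbT; apply: leq_trans wo.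
move=> x; rewrite mem_cat => /orP[|]; first rewrite mem_cat => /orP[|/oP //].
  by rewrite inE => /eqP->; case: br.
by rewrite !inE => /orP[]/eqP-> //; case: br.
Qed.

(** * Distinctness of the differences within one cycle *)

Lemma pairs_cat P Q : pairs (P ++ Q) = pairs P ++ pairs Q.
Proof. by rewrite /pairs map_cat flatten_cat. Qed.

(** The quotient by [M] is the run, so only the few elements of [R], all outside the runs in [L],
    need to be compared with one another. *)
Lemma uniq_runs (L : seq nat) (g : nat -> nat) (R : seq nat) :
    uniq L -> {in L, forall t, (g t).+1 < M}%N -> uniq R ->
    {in R, forall x, (x %/ M)%N \notin L} ->
  uniq (pairs [seq el t (g t) | t <- L] ++ R).
Proof.
elim: L => //= t L IH /andP[tL uL] gM uR dR.
have gt := gM t (mem_head _ _).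
have runs x : x \in pairs [seq el t (g t) | t <- L] -> (x %/ M)%N \in L.
  have gL c : c \in L -> ((g c).+1 < M)%N by move=> cL; apply: gM; rewrite inE cL orbT.
  rewrite mem_pairs => /orP[/mapP[c cL ->]|/andP[x0 /mapP[c cL xE]]].
    by rewrite el_div // ltnW // gL.
  by rewrite -(prednK x0) xE elS el_div // gL.
have t_notin x : (x %/ M)%N = t -> x \notin pairs [seq el t (g t) | t <- L] ++ R.
  move=> xt; rewrite mem_cat negb_or; apply/andP; split.
    by apply/negP => /runs; rewrite xt (negPf tL).
  by apply/negP => /dR; rewrite xt inE eqxx.
rewrite /pairs /= -/(pairs _) inE negb_or.
have -> : (el t (g t) == (el t (g t)).+1) = false by apply: ltn_eqF.
rewrite !t_notin ?elS ?el_div //; last exact: ltnW.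
rewrite IH // => [c cL|x xR]; first by apply: gM; rewrite inE cL orbT.
by have := dR x xR; rewrite inE negb_or => /andP[].
Qed.

Lemma uniq_elements U L g T K :
    uniq L -> {in L, forall t, (g t).+1 < M}%N -> uniq (U ++ pairs T ++ K) ->
    {in U ++ pairs T ++ K, forall x, (x %/ M)%N \notin L} ->
  uniq ((U ++ pairs ([seq el t (g t) | t <- L] ++ T)) ++ K).
Proof.
move=> uL gM uR dR; rewrite pairs_cat -!catA.
by rewrite (perm_uniq (permEl (perm_catCA _ _ _))); apply: uniq_runs.
Qed.

Lemma uniq_std : uniq (low ++ mid ++ high).
Proof.
rewrite !cat_uniq !iota_uniq /= andbT; apply/andP; split; apply/hasPn => t.
  by rewrite mem_cat !mem_iota /tq; clear -tp_gt0; case: (dl) => /=; lia.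
by rewrite !mem_iota /tq; clear -tp_gt0; case: (dl) => /=; lia.
Qed.

Lemma notin_std t : t = tp \/ t = tq \/ t = s -> t \notin low ++ mid ++ high.
Proof.
move=> h; rewrite !mem_cat !mem_iota; move: h; rewrite /s /tq; clear -tp_gt0.
by case: (dl) => /=; lia.
Qed.

Lemma low1_low : low = 0%N :: low1.
Proof. by rewrite /low /low1 -{1}(prednK tp_gt0). Qed.

Lemma slot_posM t J : (J < w + o)%N || (0 < t)%N && (J < n)%N -> ((slot_pos t J).+1 < M)%N.
Proof.
move=> h; apply: slot_pos_lt; move: h w_le_n; clear.
by move: (w) (n) => w' n'; case: (t =P 0%N); lia.
Qed.

Lemma spare_div c : (c.2 < n)%N -> (spare c %/ M)%N = c.1 /\ ((spare c).+1 %/ M)%N = c.1.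
Proof.
by move=> cn; have h := pair_pos_lt c.1 cn; rewrite /spare elS !el_div // ltnW.
Qed.

Lemma spare_mod c : (c.2 < n)%N ->
  ((spare c %% M).-1)./2 = c.2 /\ (((spare c).+1 %% M).-1)./2 = c.2.
Proof.
move=> cn; have h := pair_pos_lt c.1 cn; rewrite /spare elS /el !modnMDl !modn_small //.
  by rewrite /pair_pos; clear; case: eqP => [->|]; case: (eps _); lia.
exact: ltnW.
Qed.

Lemma uniq_spares cs : uniq cs -> {in cs, forall c, c.2 < n}%N -> uniq (pairs (map spare cs)).
Proof.
elim: cs => // c cs IH /= /andP[ccs ucs] csn.
have mems x : x \in pairs (map spare cs) -> ((x %/ M)%N, ((x %% M).-1)./2) \in cs.
  have cn c' : c' \in cs -> (c'.2 < n)%N by move=> h; apply: csn; rewrite inE h orbT.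
  rewrite mem_pairs => /orP[/mapP[c' c'cs ->]|/andP[x0 /mapP[c' c'cs xE]]].
    by have [-> _] := spare_div (cn _ c'cs); have [-> _] := spare_mod (cn _ c'cs);
      rewrite -surjective_pairing.
  rewrite -(prednK x0) xE.
  by have [_ ->] := spare_div (cn _ c'cs); have [_ ->] := spare_mod (cn _ c'cs);
    rewrite -surjective_pairing.
have cn : (c.2 < n)%N by apply: csn; apply: mem_head.
have [d1 d2] := spare_div cn; have [m1 m2] := spare_mod cn.
rewrite /pairs /= -/(pairs _) inE negb_or (ltn_eqF (ltnSn _)) /=.
apply/and3P; split.
- by apply: contra ccs => /mems; rewrite d1 m1; case: (c).
- by apply: contra ccs => /mems; rewrite d2 m2; case: (c).
- by apply: IH => // c' h; apply: csn; rewrite inE h orbT.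
Qed.

Lemma tp_tq : (tp < tq)%N. Proof. by rewrite /tq addSn ltnS leq_addr. Qed.

Lemma s_eq : s.*2.+1 = (tp + dl + tp.-1).+2.*2.+1%N.
Proof. by rewrite /s; clear -tp_gt0; lia. Qed.

Lemma bulk_size i : size ((bulk_U i ++ pairs (bulk_P i)) ++ bulk_K i) = s.*2.+1.
Proof.
rewrite !size_cat size_pairs !size_cat !size_map !size_cat !size_iota s_eq /=.
by clear; lia.
Qed.

Lemma first_size : size ((first_U ++ pairs first_P) ++ first_K) = s.*2.+1.
Proof.
rewrite !size_cat size_pairs !size_cat !size_map !size_cat !size_iota s_eq /=.
by rewrite /first_U /first_K; clear -tp_gt0; case: wrap => /=; lia.
Qed.

Lemma second_size : size ((second_U ++ pairs second_P) ++ second_K) = s.*2.+1.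
Proof.
have sP : size second_P = (tp.-1 + tp.-1 + size extra_pairs).+1.
  by rewrite [LHS]/= size_cat !size_map size_cat !size_iota.
rewrite size_cat [size (second_U ++ _)]size_cat size_pairs sP s_eq.
have -> : size extra_pairs = (1 + dl)%N by rewrite /extra_pairs; case: (dl); case: (omega).
by rewrite [size second_U]/= [size second_K]/=; clear -tp_gt0; lia.
Qed.

Lemma bulk_uniq i : (i < w)%N -> uniq ((bulk_U i ++ pairs (bulk_P i)) ++ bulk_K i).
Proof.
move=> iw; pose c := nth (0, 0)%N spare_pairs i.
have cs : c \in all_spare by apply/spare_all/mem_spare.
have cn : (c.2 < n)%N.
  move: (mem_all_spare cs) t0_le; rewrite /t0; clear; move: (n) (c.2) => n' J h.
  by case: h => -[_ h]; lia.
have [d1 d2] := spare_div cn.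
have rw := twice_lt iw.
have p_lt : (3 + i < M)%N by apply: leq_trans eta_lt_M; move: succ_w; clear -iw; lia.
have q_lt : (t0 + eta.*2 - 2 - twice i < M)%N.
  by apply: leq_ltn_trans t0_lt_M; rewrite -subnDA leq_subr.
have z_lt : (eta + twice i - i < M)%N.
  by have [/andP[_ h] _] := double_mod_sub succ_w iw;
    apply: leq_trans h (ltnW (ltnW (ltnW eta_lt_M))).
apply: uniq_elements.
- exact: uniq_std.
- move=> t _; apply: slot_posM; apply/orP; left.
  exact: ltn_addr (sg_lt t iw).
- have lt_tq : (el tp (3 + i) < tq * M)%N by apply: el_lt tp_tq p_lt.
  have h1 : (tq * M <= el tq (t0 + eta.*2 - 2 - twice i) < s * M)%N.
    by rewrite el_ge //=; apply: el_lt q_lt; case/andP: tq_range.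
  have h2 : (s * M <= el s (eta + twice i - i))%N by rewrite el_ge.
  have hc : (spare c).+1 != el tp (3 + i) /\ spare c != el tp (3 + i) /\
      (spare c).+1 != el tq (t0 + eta.*2 - 2 - twice i) /\
      spare c != el tq (t0 + eta.*2 - 2 - twice i).
    have xJ : (0 < (3 + i).-1./2 <= eta)%N by move: succ_w; clear -iw; lia.
    have yJ := q_block rw; have [m1 m2] := spare_mod cn.
    have sep x t y : (x %/ M)%N = c.1 -> ((x %% M).-1)./2 = c.2 -> (y < M)%N ->
        ~ (c.1 = t /\ c.2 = (y.-1)./2) -> x != el t y.
      move=> xt xm yM ne; apply/eqP => E; apply: ne.
      by rewrite -xt -xm E el_div // /el modnMDl modn_small.
    have n1 : ~ (c.1 = tp /\ c.2 = (3 + i).-1./2).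
      case=> c1 c2; case: (mem_all_spare cs) => -[c1']; last first.
        by move: tq_neq_tp; rewrite -c1' c1 eqxx.
      by rewrite c2 ltnNge; case/andP: xJ => _ ->.
    have n2 : ~ (c.1 = tq /\ c.2 = (t0 + eta.*2 - 2 - twice i).-1./2).
      case=> c1 c2; case: (mem_all_spare cs) => -[c1'].
        by move: tq_neq_tp; rewrite -c1' c1 eqxx.
      rewrite c2; move: yJ; case/andP => y1 y2; case=> [|/andP[]].
        by rewrite ltnNge y1.
      by rewrite leqNgt y2.
    by split; [|split; [|split]]; apply: sep.
  have sc : ((spare c).+1 < s * M)%N.
    case: (mem_all_spare cs) => -[c1 _]; rewrite /spare elS c1.
      by apply: el_lt; [case/andP: tp_range|exact: pair_pos_lt].
    by apply: el_lt; [case/andP: tq_range|exact: pair_pos_lt].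
  move: lt_tq h1 h2 hc sc; rewrite /bulk_U /bulk_K /= !inE -/c.
  move: (el tp _) (el tq _) (el s _) (spare c) (tq * M)%N (s * M)%N; clear.
  by move=> p q z d A B; lia.
move=> x; rewrite !inE => /orP[/eqP->|/or4P[/eqP->|/eqP->|/eqP->|/eqP->]].
- by rewrite el_div //; apply: notin_std; left.
- by rewrite d1; apply: notin_std; case: (mem_all_spare cs) => -[-> _]; [left|right; left].
- by rewrite d2; apply: notin_std; case: (mem_all_spare cs) => -[-> _]; [left|right; left].
- by rewrite el_div //; apply: notin_std; right; left.
- by rewrite el_div //; apply: notin_std; right; right.
Qed.

Lemma first_uniq : uniq ((first_U ++ pairs first_P) ++ first_K).
Proof.
have uL : uniq (low1 ++ mid ++ high).
  by have := uniq_std; rewrite low1_low /= => /andP[].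
have nL t : [\/ t = 0%N, t = tp, t = tq | t = s] -> t \notin low1 ++ mid ++ high.
  move=> h; have := notin_std (t := t); rewrite low1_low /= inE negb_or.
  case: h => -> h; try by have /andP[] := h ltac:(tauto).
  by have := uniq_std; rewrite low1_low /= => /andP[].
have gM : {in low1 ++ mid ++ high, forall t, (slot_pos t w).+1 < M}%N.
  move=> t; rewrite !mem_cat !mem_iota => h.
  apply: slot_posM; apply/orP; right; rewrite w_lt_n andbT.
  by case: (posnP t) h => [->|].
have fN : (f < n.*2)%N by move: f0_lt; rewrite /f; clear; move: (n) => ?; lia.
have e0 x : el 0 x = x by rewrite /el mul0n.
have nM : (n.*2 < M)%N by [].
have bM : (b < M)%N.
  apply: leq_ltn_trans t0_lt_M; rewrite b_eq /t0; clear; case: (pib) => /=; lia.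
have aM : (eta.+1.*2 < M)%N by rewrite doubleS; apply: eta_lt_M.
have bS : (tq * M <= el tq b < s * M)%N.
  by rewrite el_ge //=; apply: el_lt bM; case/andP: tq_range.
have zS : (s * M <= el s eta.*2)%N by rewrite el_ge.
have aS : (el tp eta.+1.*2 < tq * M)%N by apply: el_lt tp_tq aM.
have fa : (M <= spare (tp, 0%N) /\ (spare (tp, 0%N)).+1 < el tp eta.+1.*2)%N.
  move: M_le_tpM; rewrite /spare /el /pair_pos /=; clear -eta_ge.
  by move: (tp * M)%N M => A M' h; case: (eps tp); lia.
have c0 : ((tp, 0%N).2 < n)%N by apply: leq_ltn_trans w_lt_n.
have [d1 d2] := spare_div c0.
have eD : (eta.*2 < M)%N by apply: ltn_trans eta_lt_M.
have divs x : x \in [:: el tp eta.+1.*2; el 0 n.*2; el 0 f; spare (tp, 0%N);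
    (spare (tp, 0%N)).+1; el tq b; el s eta.*2] -> (x %/ M)%N \notin low1 ++ mid ++ high.
  rewrite !inE.
  case/or4P=> [/eqP->|/eqP->|/eqP->|/or4P[/eqP->|/eqP->|/eqP->|/eqP->]].
  - by rewrite el_div //; apply/nL/Or42.
  - by rewrite el_div //; apply/nL/Or41.
  - by rewrite el_div ?(ltn_trans fN) //; apply/nL/Or41.
  - by rewrite d1; apply/nL/Or42.
  - by rewrite d2; apply/nL/Or42.
  - by rewrite el_div //; apply/nL/Or43.
  - by rewrite el_div //; apply/nL/Or44.
rewrite /first_U /first_K; case: wrap; apply: uniq_elements => //.
- move: fa aS bS zS fN nM; rewrite !e0 /=; move: (el tp _) (el tq b) (el s _) => a b' z.
  move: (spare _) (tq * M)%N (s * M)%N (n.*2) f M => c A B N F M'; clear.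
  by rewrite !inE; lia.
- move: fa aS bS zS fN nM; rewrite !e0 /=; move: (el tp _) (el tq b) (el s _) => a b' z.
  move: (spare _) (tq * M)%N (s * M)%N (n.*2) f M => c A B N F M'; clear.
  by rewrite !inE; lia.
- move=> x; rewrite !inE => h; apply: divs; rewrite !inE; move: h.
  by do ?[case: (x == _); rewrite ?orbT //].
Qed.

Lemma second_uniq : o -> uniq ((second_U ++ pairs second_P) ++ second_K).
Proof.
move=> ho; have wo : (w.+1 < n)%N by rewrite succ_w /n ho addn1.
pose L := 0%N :: low1 ++ high.
pose g t := if t == 0%N then slot_pos 0 w else slot_pos t w.+1.
have PE : second_P = [seq el t (g t) | t <- L] ++ map spare extra_pairs.
  rewrite /second_P /L /= /slot {1}/g eqxx; congr (_ :: (_ ++ _)).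
  apply/eq_in_map => t tL; rewrite /g ifF //; apply/negbTE.
  by apply: contraL tL => /eqP->; rewrite mem_cat !mem_iota /tq.
have uL : uniq L.
  apply: subseq_uniq uniq_std; rewrite low1_low /L -!cat_cons.
  exact: cat_subseq (subseq_refl _) (suffix_subseq mid high).
have brex : uniq (broken_pair :: extra_pairs) /\
    {in broken_pair :: extra_pairs, forall c, c.2 < n /\ tp <= c.1 <= tq}%N.
  have [z3 nE] : (3 <= zeta)%N /\ n = (omega.*2 + zeta.*2.*2 + o)%N.
    by split; [exact: zeta_ge|rewrite /n {1}omega_zeta doubleD].
  have eE := omega_zeta; move: eE nE; rewrite ho /broken_pair /extra_pairs /tq; clear -z3.
  move: (n) zeta omega z3 => n' z' w' z3.
  case: (dl); case: w' => /= eE nE; split; rewrite /= ?inE ?xpair_eqE; try lia.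
  - by move=> c; rewrite !inE => /or3P[]/eqP-> /=; lia.
  - by move=> c; rewrite !inE => /or3P[]/eqP-> /=; lia.
  - by move=> c; rewrite !inE => /orP[]/eqP-> /=; lia.
  - by move=> c; rewrite !inE => /orP[]/eqP-> /=; lia.
case: brex => ub bn.
have RE : perm_eq (second_U ++ pairs (map spare extra_pairs) ++ second_K)
    (pairs (map spare (broken_pair :: extra_pairs)) ++ [:: el s n]).
  rewrite /second_U /second_K /pairs /= -/(pairs _) perm_cons.
  by rewrite -[X in _ :: X]cat1s -[[:: _; _]]/([:: _] ++ [:: _]) perm_catCA.
have nM : (n < M)%N by rewrite /M; clear; move: (n) => ?; lia.
have mems x : x \in pairs (map spare (broken_pair :: extra_pairs)) ->
    (tp <= x %/ M <= tq)%N.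
  rewrite mem_pairs => /orP[/mapP[c cb ->]|/andP[x0 /mapP[c cb xE]]].
    by have [cn ct] := bn c cb; have [-> _] := spare_div cn.
  rewrite -(prednK x0) xE.
  by have [cn ct] := bn c cb; have [_ ->] := spare_div cn.
rewrite PE; apply: uniq_elements => //.
- move=> t tL; rewrite /g; case: (t =P 0%N) => [_|/eqP t0'].
    by apply: slot_posM; rewrite ho addn1 ltnSn.
  by apply: slot_posM; rewrite lt0n t0' wo orbT.
- rewrite (perm_uniq RE) cats1 rcons_uniq uniq_spares //; last by move=> c /bn[].
  rewrite andbT; apply/negP => /mems; rewrite el_div //.
  by case/andP: tq_range => _ h /andP[_]; rewrite leqNgt h.
move=> x; rewrite (perm_mem RE) mem_cat mem_seq1 => xR.
have : (tp <= x %/ M <= tq)%N \/ (x %/ M)%N = s.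
  by case/orP: xR => [/mems ->|/eqP->]; [left|right; apply: el_div].
rewrite /L inE mem_cat !mem_iota; move: (x %/ M)%N => t; rewrite /s /tq; clear -tp_gt0.
by case: (dl) => /=; lia.
Qed.

(** * Properties of the whole allotment *)

Hypothesis sgi_lt : forall t i, (i < w)%N -> (sgi t i < w)%N.
Hypothesis sgiK : forall t i, (i < w)%N -> sg t (sgi t i) = i.

Definition frame_elements i := (frame_U i ++ pairs (frame_P i)) ++ frame_K i.

Lemma frame_cycle i : (i < n)%N ->
  [/\ closing v (frame_U i) (frame_P i) (frame_K i), uniq (frame_elements i),
      size (frame_elements i) = s.*2.+1 & {in frame_elements i, forall x, owned i x}].
Proof.
rewrite /frame_elements /frame_U /frame_P /frame_K => ilt.
case: ltnP => [iw|wi].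
  split; [exact: bulk_closing|exact: bulk_uniq|exact: bulk_size|exact: bulk_owned].
case: eqP => [->|/eqP iw].
  split; [exact: first_closing|exact: first_uniq|exact: first_size|exact: first_owned].
have w_i : (w < i)%N by rewrite ltn_neqAle eq_sym iw.
have ho : o.
  move: ilt succ_w w_i; rewrite /n; clear; move: w => w'.
  by case: o => //; lia.
have -> : i = w.+1.
  by move: ilt succ_w w_i; rewrite /n ho; clear; move: w => w'; lia.
split; [exact: second_closing|exact: second_uniq|exact: second_size|exact: second_owned].
Qed.

Lemma owned_range i x : owned i x ->
  (0 < x <= s * M + n)%N /\ x \notin [seq (u * M + 2 * eps u)%N | u <- iota 1 s].
Proof.
have M2 : (2 < M)%N by move: eta_lt_M; clear; move: M => M'; lia.
case=> t [y [-> yM _ val]]; split.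
  move: val; rewrite /valid_pos; case: eqP => [->|_].
    by move=> /andP[y0 yn]; rewrite addn_gt0 y0 orbT leq_add2l.
  case/andP=> ts t_val; rewrite (leq_trans (ltnW (el_lt ts yM)) (leq_addr _ _)) andbT.
  move: t_val; case: eqP => [->|/eqP t_gt0 _]; first by rewrite /el mul0n.
  apply: leq_trans (el_ge y (c := 1) _); first by rewrite mul1n.
  by rewrite lt0n.
apply/negP => /mapP[u]; rewrite mem_iota => /andP[u_gt0 _] E.
have eM : (2 * eps u < M)%N by apply: leq_trans M2; case: (eps u).
have tu : t = u by have := congr1 (divn^~ M) E; rewrite !el_div.
have yE : y = (2 * eps u)%N by move: E; rewrite tu => /addnI.
move: val; rewrite /valid_pos yE tu; case: eqP => [->|_]; first by rewrite epss.
by rewrite (gtn_eqF u_gt0) eqxx andbF.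
Qed.

Lemma f0_gt0 : (0 < f0)%N.
Proof.
move: f0_eq t0_eq; rewrite b_eq /n /t0; clear -eta_ge.
by case: (pib); case: (dl); case: wrap; case: o => /=; lia.
Qed.

(** As [f0] is positive, slot 0 of run 0 is the pair 1, 2, and the bulk cycle [sgi 0 0] takes it.
    Rigidity rests on this pair. *)
Lemma frame_one : exists2 i, (i < n)%N & 1%N \in frame_P i.
Proof.
have w_gt0 : (0 < w)%N by rewrite -ltnS succ_w; move: eta_ge; clear; lia.
have iw := sgi_lt 0 w_gt0; exists (sgi 0 0)%N; first exact: ltn_trans iw w_lt_n.
rewrite /frame_P iw mem_cat; apply/orP; left; apply/mapP; exists 0%N.
  by rewrite low1_low mem_head.
by rewrite sgiK // /slot /slot_pos eqxx /pair_pos0 f0_gt0.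
Qed.

(** It does not depend on [sg], so the same number marks the bulk cycle i in every system of the
    family. *)
Definition anchor i := el s (eta + twice i - i).

Lemma anchor_in i : (i < w)%N -> anchor i \in frame_elements i.
Proof. by move=> iw; rewrite /frame_elements /frame_K iw mem_cat !inE eqxx !orbT. Qed.

Lemma slot_in i t : (i < w)%N -> t \in low ++ mid ++ high ->
  slot t (sg t i) \in frame_elements i.
Proof.
move=> iw tr; rewrite /frame_elements /frame_P iw !mem_cat mem_pairs; apply/orP; left.
apply/orP; right; rewrite mem_cat; apply/orP; left; apply/orP; left.
exact: map_f.
Qed.

Lemma slot_owner i t J : (i < n)%N -> (J < w)%N -> t \in low ++ mid ++ high ->
  slot t J \in frame_elements i -> i = sgi t J.
Proof.
move=> ilt Jw tr; have [_ _ _ own] := frame_cycle ilt.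
move/own => oi; apply: owned_unique oi _.
have iw := sgi_lt t Jw; have [_ _ _ own'] := frame_cycle (ltn_trans iw w_lt_n).
by apply: own'; rewrite -{1}(sgiK t Jw); apply: slot_in.
Qed.

End Frame.

(** This hides the parities. For the counting it suffices that each bulk cycle has a fixed anchor
    and that its cells in the s - 2 standard runs reveal the permutations. *)
Lemma frame_exists n s (eps : nat -> bool) :
    (12 <= n)%N -> (3 <= s)%N -> eps 0%N = false -> eps s = false ->
  exists (w : nat) (std : seq nat) (cell : nat -> nat -> nat) (anch : nat -> nat),
  [/\ (n <= w.+2)%N, (w < n)%N, size std = (s - 2)%N, uniq std &
    forall sg sgi : nat -> nat -> nat,
      (forall t i, (i < w)%N -> (sg t i < w)%N) ->
      (forall t i, (i < w)%N -> sgi t (sg t i) = i) ->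
      (forall t i, (i < w)%N -> (sgi t i < w)%N) ->
      (forall t i, (i < w)%N -> sg t (sgi t i) = i) ->
    exists U P K : nat -> seq nat,
    let E i := (U i ++ pairs (P i)) ++ K i in
    [/\ forall i, (i < n)%N ->
          [/\ closing (n.*2.+1 * s.*2.+1) (U i) (P i) (K i), uniq (E i),
              size (E i) = s.*2.+1 &
              {in E i, forall x, (0 < x <= s * n.*2.+1 + n)%N /\
                x \notin [seq (u * n.*2.+1 + 2 * eps u)%N | u <- iota 1 s]}],
        forall i j x, (i < n)%N -> (j < n)%N -> x \in E i -> x \in E j -> i = j,
        exists2 i, (i < n)%N & 1%N \in P i,
        forall i, (i < w)%N -> anch i \in E i /\
          {in std, forall t, cell t (sg t i) \in E i}
      & forall i t J, (i < n)%N -> (J < w)%N -> t \in std ->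
          cell t J \in E i -> i = sgi t J]].
Proof.
move=> n_ge s_ge eps0 epss.
have [eta [o nE]] : exists eta (o : bool), n = (eta.*2 + o)%N.
  by exists n./2, (odd n); rewrite addnC odd_double_half.
have [tp [dl sE]] : exists tp (dl : bool), s = (tp.*2.+1 + dl)%N.
  by exists s.-1./2, (odd s.-1); have := odd_double_half s.-1; lia.
have eta_ge : (6 <= eta)%N by move: n_ge; rewrite nE; case: o {nE}; lia.
have tp_gt0 : (0 < tp)%N by move: s_ge; rewrite sE; case: dl {sE}; lia.
have [j0 [pib t0_eq]] : exists j0 (pib : bool), (j0.*2.+1 + pib + dl = eta + o.*2)%N.
  pose t := (eta + o.*2 - dl).-1; exists t./2, (odd t).
  have tE : (t.+1 + dl = eta + o.*2)%N.
    by rewrite /t; move: eta_ge; clear; case: (dl); case: (o) => /=; lia.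
  by have := odd_double_half t; move: tE; clear; move: t => t; lia.
pose b := if pib then j0.*2.+1 else (j0 + eta).*2.
(* Chosen so that the two sides of the equation for [f0] have the same parity. *)
pose wrap := odd (b + dl).
have [f0 f0_eq] : exists f0, (b + dl + f0.*2.+2 =
    (eta.*2 + o).*2 + (if wrap then o.*2.+1 else 0))%N.
  exists ((eta.*2 + o).*2 + (if wrap then o.*2.+1 else 0) - (b + dl).+2)./2.
  have b_le : ((b + dl).+2 <= (eta.*2 + o).*2)%N.
    move: t0_eq eta_ge; rewrite /b; clear; case: pib; case: dl; case: o => /=; lia.
  have := odd_double_half (b + dl); rewrite -/wrap; move: b_le; clear.
  move: wrap (b + dl)%N (eta.*2 + o)%N => wr B N'.
  by case: wr => /=; lia.
subst n s; exists eta.*2.-1, (low tp ++ mid tp dl ++ high tp dl).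
exists (slot eta tp f0 o dl eps), (anchor eta tp o dl).
have wE : (eta.*2.-1).+1 = eta.*2 by rewrite prednK // double_gt0; apply: leq_trans eta_ge.
split.
- by rewrite wE; case: (o); lia.
- by rewrite wE leq_addr.
- by rewrite !size_cat !size_iota; case: (dl); lia.
- exact: uniq_std.
move=> sg sgi sg_lt sgK sgi_lt sgiK.
pose E := frame_elements eta tp j0 f0 b o dl pib wrap eps sg.
have cyc i := @frame_cycle eta tp j0 f0 b o dl pib wrap eps sg sgi eta_ge tp_gt0
  eps0 epss t0_eq erefl f0_eq sg_lt sgK i.
exists (frame_U eta tp f0 o dl wrap eps), (frame_P eta tp j0 f0 o dl eps sg).
exists (frame_K eta tp j0 b o dl pib wrap eps) => /=; split.
- move=> i ilt; have [c u sz own] := cyc i ilt; split=> // x /own.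
  exact: (owned_range eta_ge tp_gt0 eps0 epss t0_eq erefl f0_eq).
- move=> i j x ilt jlt xi xj; have [_ _ _ own] := cyc i ilt.
  have [_ _ _ own'] := cyc j jlt; exact: owned_unique (own x xi) (own' x xj).
- exact: (frame_one eta_ge tp_gt0 eps0 epss t0_eq erefl f0_eq sgi_lt sgiK).
- move=> i iw; split; first exact: anchor_in.
  by move=> t tr; apply: slot_in.
- exact: (slot_owner eta_ge tp_gt0 eps0 epss t0_eq erefl f0_eq sg_lt sgK sgi_lt sgiK).
Qed.

(** * Counting *)

(** Induction over the enumeration of [T], so that no choice axiom enters. *)
Lemma fin_choice (T : finType) (Y : Type) (y0 : Y) (P : T -> Y -> Prop) :
  (forall x, exists y, P x y) -> exists f : T -> Y, forall x, P x (f x).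
Proof.
move=> PT; suff [f Pf] : exists f : T -> Y, {in enum T, forall x, P x (f x)}.
  by exists f => x; apply: Pf; rewrite mem_enum.
elim: (enum T) => [|x r [f Pf]]; first by exists (fun=> y0).
have [y Py] := PT x; exists (fun z => if z == x then y else f z) => z.
by rewrite inE; case: eqP => [-> _|_ /= /Pf].
Qed.

Lemma uniq_flatten_nth (T : eqType) (ss : seq (seq T)) :
    (forall i, (i < size ss)%N -> uniq (nth [::] ss i)) ->
    (forall i j x, (i < size ss)%N -> (j < size ss)%N ->
       x \in nth [::] ss i -> x \in nth [::] ss j -> i = j) ->
  uniq (flatten ss).
Proof.
elim: ss => //= t ss IH us dis; rewrite cat_uniq (us 0%N) //= IH; last first.
- by move=> i j x iss jss xi xj; have [] := dis i.+1 j.+1 x iss jss xi xj.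
- by move=> i iss; apply: (us i.+1).
rewrite andbT; apply/hasPn => x /flattenP[t' /(nthP [::])[i iss <-] xi].
by apply/negP => xt; have := dis 0%N i.+1 x isT iss xt xi.
Qed.

Section Count.

Variables (n k : nat).
Hypotheses (n_ge : (12 <= n)%N) (k_ge : (7 <= k)%N) (k_odd : odd k).

Let M := n.*2.+1.
Let v := (M * k)%N.
Let s := k./2.

Let v_gt1 : (1 < v)%N. Proof. by rewrite /v /M; move: k_ge; clear; nia. Qed.
Let v_odd : odd v. Proof. by rewrite /v oddM k_odd /M /= odd_double. Qed.
Let k_gt2 : (2 < k)%N. Proof. exact: leq_trans k_ge. Qed.
Let kE : k = s.*2.+1. Proof. by rewrite -[LHS]odd_double_half k_odd. Qed.
Let V_eq : v.-1./2 = (s * M + n)%N.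
Proof. by rewrite /v {1}kE /M; clear; nia. Qed.

Let T := {set {set {set 'Z_v}}}.

Lemma frame_system (eps : nat -> bool) (L0 : seq (base_cycle v)) (U P K : nat -> seq nat) :
    let E i := (U i ++ pairs (P i)) ++ K i in
    base_ok k L0 ->
    norms L0 = [seq (u * M + 2 * eps u)%N | u <- iota 1 s] -> eps s = false ->
    (forall i, (i < n)%N ->
      [/\ closing v (U i) (P i) (K i), uniq (E i), size (E i) = k &
        {in E i, forall x, (0 < x <= s * M + n)%N /\
           x \notin [seq (u * M + 2 * eps u)%N | u <- iota 1 s]}]) ->
    (forall i j x, (i < n)%N -> (j < n)%N -> x \in E i -> x \in E j -> i = j) ->
    (exists2 i, (i < n)%N & 1%N \in P i) ->
  exists L : seq (base_cycle v),
    [/\ base_ok k L, uniq (norms L), is_kcycle_system k (list_system k L),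
        translation_invariant (list_system k L) /\ rigid (list_system k L)
      & (n <= size L)%N /\
        forall i, (i < n)%N -> step_norms (nth (base0 v) L i) =i E i].
Proof.
move=> E ok0 norms0 epss cyc dis [i1 i1n P1].
pose good (i : 'I_n) (b : base_cycle v) :=
  [/\ periodic_cycle k (period b) (shift b) (vertex b),
      perm_eq (step_norms b) (E i)
    & 1%N \in P i -> exists a e, [/\ e = 1 \/ e = -1,
        vertex b a.+1 = vertex b a + e + e & vertex b a.+2 = vertex b a + e]].
have [|B HB] := @fin_choice _ _ (base0 v) good.
  move=> i; have [c u sz rng] := cyc i (ltn_ord i).
  have uD : uniq (U i ++ pairs (P i)) by move: u; rewrite cat_uniq => /and3P[].
  have rngV : {in E i, forall x, (0 < x <= v.-1./2)%N}.
    by move=> x /rng[]; rewrite V_eq.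
  have [W [pW nW oneW]] := zigzag_cycle v_gt1 v_odd k_gt2 uD rngV sz c.
  exists (BaseCycle k (0 : 'Z_v) (walkZ v k 0 W)); split=> //=.
  have -> : step_norms (BaseCycle k 0 (walkZ v k 0 W)) =
      sort geq (U i ++ pairs (P i)) ++ K i.
    apply: (@eq_from_nth _ 0%N).
      by rewrite size_step_norms /= size_cat size_sort -size_cat.
    move=> a; rewrite size_step_norms => ak; rewrite step_norms_nth //=; exact: nW.
  by rewrite perm_cat2r perm_sort.
pose L1 := [seq B i | i <- enum 'I_n]; pose L := L1 ++ L0.
have size1 : size L1 = n by rewrite size_map size_enum_ord.
have nth1 (i : 'I_n) : nth (base0 v) L i = B i.
  rewrite nth_cat size1 ltn_ord (nth_map i) ?size_enum_ord //.
  by rewrite nth_ord_enum.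
have okL : base_ok k L.
  apply: base_ok_cat => // i; rewrite size1 => ilt /=.
  have := nth1 (Ordinal ilt); rewrite nth_cat size1 /= ilt => ->.
  by case: (HB (Ordinal ilt)).
have memL i : (i < n)%N -> step_norms (nth (base0 v) L i) =i E i.
  move=> ilt x; rewrite (nth1 (Ordinal ilt)); have [_ p _] := HB (Ordinal ilt).
  by rewrite (perm_mem p).
have nthL1 i : (i < n)%N -> nth [::] (map (@step_norms v) L1) i =
    step_norms (B (insubd (Ordinal i1n) i)).
  move=> ilt; rewrite (nth_map (base0 v)) ?size1 //.
  have := nth1 (Ordinal ilt); rewrite nth_cat size1 /= ilt => ->.
  by congr (step_norms (B _)); apply/val_inj; rewrite val_insubd ilt.
have insE i : (i < n)%N -> (insubd (Ordinal i1n) i : nat) = i.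
  by move=> ilt; rewrite val_insubd ilt.
have mem1 i x : (i < n)%N -> x \in nth [::] (map (@step_norms v) L1) i -> x \in E i.
  move=> ilt; rewrite nthL1 //; have [_ p _] := HB (insubd (Ordinal i1n) i).
  by rewrite (perm_mem p) insE.
have uL : uniq (norms L).
  rewrite /norms map_cat flatten_cat cat_uniq; apply/and3P; split.
  - apply: uniq_flatten_nth => [i|i j x]; rewrite size_map size1.
      move=> ilt; rewrite nthL1 //; have [_ p _] := HB (insubd (Ordinal i1n) i).
      by rewrite (perm_uniq p) insE //; case: (cyc i ilt).
    by move=> ilt jlt /(mem1 _ _ ilt) xi /(mem1 _ _ jlt) xj; apply: dis xi xj.
  - rewrite -/(norms L0) norms0; apply/hasPn => x xr; apply/negP.
    case/flattenP=> t /(nthP [::])[i]; rewrite size_map size1 => ilt <- /(mem1 _ _ ilt) xi.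
    by have [_ _ _ /(_ x xi)[_]] := cyc i ilt; rewrite xr.
  rewrite -/(norms L0) norms0 map_inj_in_uniq ?iota_uniq // => x y _ _ E2.
  have M2 : (2 < M)%N by rewrite /M; move: n_ge; clear; lia.
  have sm (u : nat) : (2 * eps u < M)%N by apply: leq_trans M2; case: (eps u).
  by have := congr1 (divn^~ M) E2; rewrite !divnMDl // !divn_small // !addn0.
have subL : {subset norms L <= iota 1 v.-1./2}.
  move=> x; rewrite /norms map_cat flatten_cat mem_cat mem_iota add1n ltnS V_eq.
  case/orP => [/flattenP[t /(nthP [::])[i]]|].
    rewrite size_map size1 => ilt <- /(mem1 _ _ ilt) xi.
    by have [_ _ _ /(_ x xi)[]] := cyc i ilt.
  rewrite -/(norms L0) norms0 => /mapP[u]; rewrite mem_iota => /andP[u1 us] ->.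
  rewrite add1n ltnS in us; apply/andP; split.
    by rewrite addn_gt0 muln_gt0 u1.
  have [->|us'] := eqVneq u s; first by rewrite epss muln0 addn0 leq_addr.
  have lt_us : (u < s)%N by rewrite ltn_neqAle us' us.
  apply: leq_trans (leq_trans (leq_mul lt_us (leqnn M)) (leq_addr _ _)).
  rewrite [(u.+1 * M)%N]mulSn [(M + _)%N]addnC leq_add2l.
  apply: leq_trans (_ : 2 <= _)%N; first by case: (eps u).
  by rewrite /M; move: n_ge; clear; lia.
have size_norms : size (norms L) = v.-1./2.
  rewrite /norms map_cat flatten_cat size_cat -/(norms L0) norms0 size_map size_iota.
  have -> : size (flatten (map (@step_norms v) L1)) = (n * k)%N.
    rewrite size_flatten /shape -map_comp sumnE big_map -[RHS]/(n * k)%N.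
    rewrite /L1 big_map big_enum /= (eq_bigr (fun=> k)) => [|i _].
      by rewrite sum_nat_const card_ord.
    have [_ p _] := HB i; by rewrite (perm_size p); case: (cyc i (ltn_ord i)).
  by rewrite V_eq /M {1}kE; clear; nia.
(* The n k differences of the full orbits and the s short ones are (v - 1) / 2 distinct values in
   the right range, hence all of them. *)
have fullL : {subset iota 1 v.-1./2 <= norms L}.
  move=> x; have [|_ ->] := uniq_min_size uL subL; last by [].
  by rewrite size_iota size_norms.
exists L; split=> //.
- exact: list_system_kcycle_system.
- split; first exact: list_system_invariant.
  have [_ _ /(_ P1)[a [e [e1 f1 f2]]]] := HB (Ordinal i1n).
  have i1L : (i1 < size L)%N by rewrite size_cat size1 ltn_addr.
  apply: (list_system_rigid v_gt1 v_odd k_gt2 okL uL fullL i1L e1 (a := a)).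
    by rewrite (nth1 (Ordinal i1n)).
  by rewrite (nth1 (Ordinal i1n)).
by split; [rewrite size_cat size1 leq_addr|].
Qed.

End Count.

Section Many.

Variables (n k : nat).
Hypotheses (n_ge : (12 <= n)%N) (k_ge : (7 <= k)%N) (k_odd : odd k).

Lemma many_systems : exists2 w, (n <= w.+2)%N &
  (w`! ^ (k./2 - 2) <= NC (n.*2.+1 * k) k * (n.*2.+1 * k) ^ 2)%N.
Proof.
pose M := n.*2.+1; pose s := k./2; pose v := (M * k)%N.
have kE : k = s.*2.+1 by rewrite -[LHS]odd_double_half k_odd.
have s_ge : (3 <= s)%N by rewrite /s; move: k_ge; clear; lia.
have v_gt1 : (1 < v)%N by rewrite /v /M; move: k_ge; clear; nia.
have v_odd : odd v by rewrite oddM k_odd /= odd_double.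
have k_gt2 : (2 < k)%N by apply: leq_trans k_ge.
have n_gt0 : (0 < n)%N by apply: leq_trans n_ge.
have [|||eps0 [L0 [ok0 epss0 norms0]]] := short_cover n_gt0 k_gt2 k_odd (m := k) (e := 1).
- by [].
- by rewrite muln1.
- by move=> p q _ q_pr _; rewrite dvdn1 => /eqP q1; rewrite q1 in q_pr.
(* [short_cover] leaves the value at 0 free. *)
pose eps u := (0 < u)%N && eps0 u.
have epss : eps s = false by rewrite /eps epss0 andbF.
have {}norms0 : norms L0 = [seq (u * M + 2 * eps u)%N | u <- iota 1 s].
  by rewrite /norms norms0; apply/eq_in_map => u; rewrite mem_iota /eps => /andP[-> _].
have [w [std [cell [anch [w_ge w_lt size_std uniq_std H]]]]] :=
  frame_exists n_ge s_ge (erefl : eps 0%N = false) epss.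
exists w => //; pose X := {ffun 'I_(s - 2) -> {perm 'I_w}}.
(* The run [t] uses the permutation numbered by its rank in [std]; everything outside the standard
   runs and the bulk cycles is left fixed. *)
pose act (sg : X) t i := if insub (index t std) is Some a then
  if insub i is Some j then (sg a j : nat) else i else i.
pose inv (sg : X) : X := [ffun a => (sg a)^-1%g].
have insub_ord m (j : 'I_m) : insub (j : nat) = Some j by exact: valK.
have act_lt sg t i : (i < w)%N -> (act sg t i < w)%N.
  by move=> iw; rewrite /act; case: insubP => // a _ _; rewrite -[i]/(Ordinal iw : nat) insub_ord.
have actK sg t i : (i < w)%N -> act (inv sg) t (act sg t i) = i.
  move=> iw; rewrite /act; case: insubP => [a _ _|//]. 
  by rewrite -[i]/(Ordinal iw : nat) !insub_ord ffunE permK.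
have invK sg : inv (inv sg) = sg by apply/ffunP => a; rewrite !ffunE invgK.
have actVK sg t i : (i < w)%N -> act sg t (act (inv sg) t i) = i.
  by move=> iw; rewrite -{1}[sg]invK actK.
pose good (sg : X) (B : {set {set {set 'Z_v}}}) := exists L : seq (base_cycle v),
  [/\ B = list_system k L, base_ok k L /\ uniq (norms L),
      [/\ is_kcycle_system k B, translation_invariant B & rigid B],
      (n <= size L)%N /\ (forall i, (i < w)%N ->
        anch i \in step_norms (nth (base0 v) L i) /\
        {in std, forall t, cell t (act sg t i) \in step_norms (nth (base0 v) L i)})
    & forall i t J, (i < n)%N -> (J < w)%N -> t \in std ->
        cell t J \in step_norms (nth (base0 v) L i) -> i = act (inv sg) t J].
have [|B goodB] := fin_choice (set0 : {set {set {set 'Z_v}}}) (P := good).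
  move=> sg; have [||||U [P [K [cyc dis one own own']]]] := H (act sg) (act (inv sg)).
  - by move=> *; apply: act_lt.
  - by move=> *; apply: actK.
  - by move=> *; apply: act_lt.
  - by move=> *; apply: actVK.
  have [|||L [okL uL sysL [TIL rigL] [szL memL]]] :=
    frame_system n_ge k_ge k_odd (U := U) (P := P) (K := K) ok0 norms0 epss.
  - by move=> i /cyc; rewrite -/s -kE.
  - exact: dis.
  - exact: one.
  exists (list_system k L), L; split=> //.
  - split=> // i iw; rewrite memL; last exact: ltn_trans w_lt.
    have [-> own2] := own i iw; split=> // t /own2; rewrite memL //.
    exact: ltn_trans w_lt.
  - by move=> i t J ilt Jw ts; rewrite memL //; apply: own'.
have injB : injective B.
  move=> sg sg' eB; have [L [BL [okL uL] _ [szL inL] _]] := goodB sg.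
  have [L' [BL' [okL' uL'] _ [szL' inL'] ownL']] := goodB sg'.
  apply/ffunP => a; apply/permP => j; apply/val_inj => /=.
  have aS : (a < size std)%N by rewrite size_std.
  pose t := nth 0%N std a; have tS : t \in std by apply: mem_nth.
  have actE (r : X) : act r t j = r a j.
    by rewrite /act index_uniq // !insub_ord.
  have j_n : (j < n)%N by apply: ltn_trans w_lt.
  have [an ce] := inL j (ltn_ord j).
  have [||j' j'L [an' ce']] :=
    list_system_norms v_gt1 v_odd k_gt2 okL okL' _ _ an (ce t tS).
  - by rewrite -BL -BL'.
  - exact: leq_trans szL.
  (* The anchor of j is the same difference in both systems, and it lies in only one base cycle of
     [L']. *)
  have j'E : j' = j.
    apply: (norms_inj uL' j'L _ an'); first exact: leq_trans szL'.
    by have [] := inL' j (ltn_ord j).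
  (* The cell that [sg] gives to j thus lies in the cycle j of the second system, so [sg'] gives the
     same cell to j. *)
  rewrite j'E in ce'; have := ownL' _ _ _ j_n (act_lt _ _ _ (ltn_ord j)) tS ce'.
  move=> /(congr1 (act sg' t)); rewrite actVK ?act_lt // !actE => ->.
  by [].
have -> : (w`! ^ (s - 2) = #|[set B sg | sg : X]|)%N.
  by rewrite card_imset // card_ffun card_ord card_Sn.
apply: (card_family_NC v_gt1) => _ /imsetP[sg _ ->].
by have [L [_ _ ]] := goodB sg.
Qed.

End Many.

(** * Numerical estimates and conclusion *)

Lemma expn_leq_fact b m : (b ^ (m - b) <= m`!)%N.
Proof.
elim: m => [|m IH]; first by rewrite sub0n.
have [le_bm|lt_mb] := leqP b m.
  by rewrite subSn // expnS factS leq_mul // ltnW.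
by rewrite (eqP (_ : m.+1 - b == 0)%N) ?fact_gt0 // subn_eq0.
Qed.

(** The left side is at most 2 ^ (4 n + 5), and w! is at least 64 ^ (w - 64), hence at least 2 ^ (6
    (n - 66)). The exponents compare as soon as 2 n >= 401. *)
Lemma fact_growth n w : (201 <= n)%N -> (n <= w.+2)%N ->
  (7 * n.*2.+1 ^ 2 * 4 ^ n <= w`!)%N.
Proof.
move=> n_ge n_le; apply: leq_trans (expn_leq_fact 64 w).
apply: leq_trans (_ : 2 ^ (4 * n + 5) <= _)%N; last first.
  rewrite -[64%N]/(2 ^ 6)%N -expnM leq_exp2l //; lia.
have le2 : (n.*2.+1 <= 2 ^ n.+1)%N.
  by have := ltn_expl n (ltnSn 1); rewrite expnS; lia.
apply: (@leq_trans (2 ^ 3 * (2 ^ n.+1) ^ 2 * (2 ^ 2) ^ n)).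
  by rewrite !leq_mul // leq_exp2r.
by rewrite -!expnM -!expnD leq_exp2l //; lia.
Qed.

(** With k = 7 + 2 c the exponent is c + 1. One factor w! absorbs 7 (2 n + 1) ^ 2 4 ^ n, and the
    other c, each at least 3, absorb the rest of k through k <= 7 * 3 ^ c. *)
Lemma count_growth n k w : (201 <= n)%N -> (7 <= k)%N -> odd k -> (n <= w.+2)%N ->
  (4 ^ n * (n.*2.+1 * k) ^ 2 <= w`! ^ (k./2 - 2) * k)%N.
Proof.
move=> n_ge k_ge k_odd n_le; have w_ge := fact_growth n_ge n_le.
have [c kE] : exists c, (k = 7 + c.*2)%N.
  by exists (k./2 - 3)%N; have := odd_double_half k; rewrite k_odd; lia.
have -> : (k./2 - 2 = c.+1)%N by rewrite kE; lia.
have w_gt2 : (3 <= w`!)%N.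
  apply: leq_trans w_ge; rewrite -mulnA; apply: leq_trans (leq_pmulr _ _) => //.
  by rewrite muln_gt0 !expn_gt0.
rewrite expnMn [(k ^ 2)%N]expnS expn1 !mulnA leq_mul2r; apply/orP; right.
rewrite expnS; apply: leq_trans (leq_mul w_ge (leqnn _)).
have kc : (k <= 7 * 3 ^ c)%N.
  rewrite kE; elim: c {kE} => // c; rewrite expnS; lia.
apply: (@leq_trans (4 ^ n * n.*2.+1 ^ 2 * (7 * w`! ^ c))); last first.
  by rewrite leq_eqVlt; apply/orP; left; apply/eqP; ring.
apply: leq_mul; first by rewrite -mulnA.
apply: leq_trans kc _; rewrite leq_mul2l /=.
by elim: (c) => // c' IH; rewrite !expnS leq_mul.
Qed.

Theorem proposition8 :
  exists N : nat, forall n k : nat,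
    (1 < n)%N -> (5 < k)%N -> odd k -> (N <= n)%N ->
    ((n %% 28)%N \in [:: 3; 5; 24; 26]%N ->
       (335%:R / 100%:R) ^+ n / k%:R <= (NC (2 * n * k + k)%N k)%:R :> rat) /\
    ((n %% 28)%N \notin [:: 3; 5; 24; 26]%N ->
       (249%:R / 100%:R) ^+ n / k%:R <= (NC (2 * n * k + k)%N k)%:R :> rat).
Proof.
exists 201%N => n k _ k_gt5 k_odd n_ge.
have k_ge : (7 <= k)%N by rewrite ltn_neqAle k_gt5 andbT; apply: contraTneq k_odd => <-.
rewrite (_ : 2 * n * k + k = n.*2.+1 * k)%N; last by rewrite -mul2n mulSn addnC.
(* Both 3.35 and 2.49 lie below 4, so a single bound gives the two cases. *)
have bound (q : rat) : 0 <= q -> q <= 4 -> q ^+ n / k%:R <= (NC (n.*2.+1 * k) k)%:R.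
  move=> q_ge0 q_le4; have k_gt0 : (0 < k)%N by apply: leq_trans k_ge.
  have [w n_le many] := many_systems (leq_trans (isT : 12 <= 201)%N n_ge) k_ge k_odd.
  have grow := leq_trans (count_growth n_ge k_ge k_odd n_le) (leq_mul many (leqnn k)).
  have {grow} : (4 ^ n <= NC (n.*2.+1 * k) k * k)%N.
    move: grow; rewrite mulnAC leq_pmul2r //.
    by rewrite expn_gt0 muln_gt0 k_gt0.
  rewrite ler_pdivrMr ?ltr0n // -natrM -(ler_nat rat) natrX.
  by apply: le_trans; rewrite lerXn2r // nnegrE.
by split=> _; apply: bound; lra.
Qed.
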